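(* For any constant $\varepsilon\in(0,1]$, there is a deterministic $\varepsilon$-clairvoyant online algorithm, namely the algorithm Shortest Lower-Bound First (SLF), that is $\lceil 1/\varepsilon\rceil$-competitive for the objective of minimizing the total flow time on a single machine with preemption. That is, on every instance the total flow time of the schedule produced by SLF is at most $\lceil 1/\varepsilon\rceil$ times the minimum total flow time of any (offline) preemptive single-machine schedule of that instance.
   Context: **Problem.** An instance is a finite set of jobs. Job $j$ has a release (arrival) time $\ge 0$ and a processing time $p_j>0$. A single machine of unit speed processes the jobs; preemption is allowed at no cost, and the machine may be time-shared (job rates are nonnegative and sum to at most $1$, so that Round-Robin with infinitesimal steps is allowed). A job may only be processed after its release and completes when it has received $p_j$ units of processing. The flow time of a job is its completion time minus its release time; the objective is the sum of the flow times of all jobs. **$\varepsilon$-clairvoyance.** The algorithm is online: it learns of a job's existence at its release, but nothing about $p_j$ at that time. The value $p_j$ is revealed to the algorithm at the moment when the remaining processing time of $j$ in the algorithm's schedule equals $\varepsilon p_j$. The value of $\varepsilon$ is assumed to be known to the algorithm. **Algorithm SLF.** At time $t$, in the schedule of SLF, let $e_j(t)$ be the amount of processing job $j$ has received up to time $t$ and $r_j(t)=p_j-e_j(t)$ its remaining processing time. A job is active at $t$ if it has been released and is not yet finished. An active job $j$ is *known* at time $t$ if $r_j(t)\le \varepsilon p_j$ and *unknown* otherwise; $K(t)$ and $U(t)$ denote the sets of known and unknown active jobs. The estimate of an active job is $\eta_j(t)=\frac{\varepsilon}{1-\varepsilon}e_j(t)$ if $j\in U(t)$ and $\eta_j(t)=r_j(t)$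 if $j\in K(t)$. (For $\varepsilon=1$ all jobs are known from their release on, and SLF is Shortest Remaining Processing Time.) At each time $t$ with at least one active job, SLF does the following, where a minimum over the empty set is $+\infty$: 1. If $\min_{j\in K(t)}\eta_j(t)\le\min_{j\in U(t)}\eta_j(t)$, it processes an arbitrary known job with minimum $\eta_j(t)$. 2. Otherwise, it processes all unknown jobs with minimum $\eta_j(t)$ in parallel at an equal rate (Round-Robin with infinitesimally small steps). *)

(* Defs.v *)
From HB Require Import structures.
From mathcomp Require Import all_boot all_order all_algebra finmap.
From mathcomp Require Import all_classical all_reals all_analysis.

Set Implicit Arguments.
Unset Strict Implicit.
Unset Printing Implicit Defensive.

Import Order.TTheory GRing.Theory Num.Theory.
Import numFieldNormedType.Exports.

Local Open Scope classical_set_scope.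
Local Open Scope ring_scope.

(* Jobs are named by natural numbers rather than by a finite type depending on
   the instance, so that instances can be compared and an online algorithm
   cannot read off the number of jobs in advance. The values of [release] and
   [proc] outside [jobs] are irrelevant. *)
Record instance (R : realType) := Instance {
  jobs : {fset nat};
  release : nat -> R;
  proc : nat -> R;
  release_ge0 : forall j, j \in jobs -> 0 <= release j;
  proc_gt0 : forall j, j \in jobs -> 0 < proc j
}.

(* [S j t] is the rate at which job [j] is processed at time [t]. *)
Definition schedule (R : realType) := nat -> R -> R.

Definition released (R : realType) (I : instance R) (j : nat) (t : R) : bool :=
  (j \in jobs I) && (release I j <= t).

Definition feasible (R : realType) (I : instance R) (S : schedule R) : Prop :=
  [/\ forall j, measurable_fun [set: R] (S j),
      forall j t, 0 <= S j t,
      forall t, \sum_(j <- jobs I) S j t <= 1 &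
      forall j t, ~~ released I j t -> S j t = 0].

Definition processed (R : realType) (S : schedule R) (j : nat) (t : R) : R :=
  \int[lebesgue_measure]_(s in `[0, t]) S j s.

Definition remaining (R : realType) (I : instance R) (S : schedule R)
    (j : nat) (t : R) : R :=
  proc I j - processed S j t.

(* Equal to [+oo] when the job is never completed. *)
Definition completion (R : realType) (I : instance R) (S : schedule R)
    (j : nat) : \bar R :=
  ereal_inf [set t%:E | t in [set t : R | 0 <= t /\ proc I j <= processed S j t]].

Definition total_flow (R : realType) (I : instance R) (S : schedule R) : \bar R :=
  (\sum_(j <- jobs I) (completion I S j - (release I j)%:E))%E.

Definition opt_flow (R : realType) (I : instance R) : \bar R :=
  ereal_inf [set total_flow I S | S in feasible I].

Definition algorithm (R : realType) := instance R -> schedule R.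

Definition competitive (R : realType) (c : R) (A : algorithm R) : Prop :=
  forall I, (total_flow I (A I) <= c%:E * opt_flow I)%E.

Definition revealed (R : realType) (eps : R) (I : instance R) (S : schedule R)
    (j : nat) (t : R) : bool :=
  remaining I S j t <= eps * proc I j.

(* What an eps-clairvoyant observer of the schedule [S] of [I] can tell about
   job [j] at time [t]: nothing before its release, then its release time, and
   from the moment of revelation on also its processing time. *)
Definition observation (R : realType) (eps : R) (I : instance R)
    (S : schedule R) (j : nat) (t : R) : option (R * option R) :=
  if released I j t then
    Some (release I j, if revealed eps I S j t then Some (proc I j) else None)
  else None.

(* Non-anticipation: the rates chosen at time [t] are a function of everything
   observed, in the algorithm's own schedule, during [0, t]. *)
Definition clairvoyant_online (R : realType) (eps : R) (A : algorithm R) : Prop :=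
  forall (I I' : instance R) (t : R), 0 <= t ->
    (forall j s, 0 <= s <= t ->
       observation eps I (A I) j s = observation eps I' (A I') j s) ->
    forall j, A I j t = A I' j t.

Definition active (R : realType) (I : instance R) (S : schedule R)
    (j : nat) (t : R) : bool :=
  released I j t && (0 < remaining I S j t).

Definition known (R : realType) (eps : R) (I : instance R) (S : schedule R)
    (j : nat) (t : R) : bool :=
  active I S j t && revealed eps I S j t.

Definition unknown (R : realType) (eps : R) (I : instance R) (S : schedule R)
    (j : nat) (t : R) : bool :=
  active I S j t && ~~ revealed eps I S j t.

(* For [eps = 1] the quotient is a division by zero, but then no job of a
   feasible schedule is ever unknown. *)
Definition estimate (R : realType) (eps : R) (I : instance R) (S : schedule R)
    (j : nat) (t : R) : R :=
  if unknown eps I S j t then eps / (1 - eps) * processed S j t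
  else remaining I S j t.

Definition min_known (R : realType) (eps : R) (I : instance R) (S : schedule R)
    (t : R) : \bar R :=
  \big[Order.min/+oo%E]_(j <- jobs I | known eps I S j t)
    (estimate eps I S j t)%:E.

Definition min_unknown (R : realType) (eps : R) (I : instance R)
    (S : schedule R) (t : R) : \bar R :=
  \big[Order.min/+oo%E]_(j <- jobs I | unknown eps I S j t)
    (estimate eps I S j t)%:E.

Definition argmin_unknown (R : realType) (eps : R) (I : instance R)
    (S : schedule R) (t : R) : {fset nat} :=
  [fset j in jobs I | unknown eps I S j t &
     (estimate eps I S j t)%:E == min_unknown eps I S t]%fset.

Definition SLF_known_step (R : realType) (eps : R) (I : instance R)
    (S : schedule R) (t : R) : Prop :=
  exists k, [/\ known eps I S k t,
                (estimate eps I S k t)%:E = min_known eps I S t &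
                forall j, S j t = (j == k)%:R].

Definition SLF_unknown_step (R : realType) (eps : R) (I : instance R)
    (S : schedule R) (t : R) : Prop :=
  forall j, S j t = if j \in argmin_unknown eps I S t
                    then (#|` argmin_unknown eps I S t|%:R)^-1 else 0.

(* The choice among known jobs of minimum estimate is arbitrary, so an instance
   may have several SLF schedules. *)
Definition is_SLF (R : realType) (eps : R) (I : instance R) (S : schedule R) :
    Prop :=
  feasible I S /\
  forall t, 0 <= t ->
    if has (fun j => active I S j t) (jobs I) then
      if (min_known eps I S t <= min_unknown eps I S t)%E
      then SLF_known_step eps I S t
      else SLF_unknown_step eps I S t
    else forall j, S j t = 0.

(* Main.v *)
Require Import Defs.
From mathcomp Require Import all_boot all_order all_algebra finmap.
From mathcomp Require Import all_classical all_reals all_analysis.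
From mathcomp Require Import measurable_realfun zify lra ring.

Import Order.TTheory GRing.Theory Num.Theory.
Import numFieldNormedType.Exports.

Local Open Scope classical_set_scope.
Local Open Scope ring_scope.

(* SLF is locally competitive: at every time it has at most c = ceil(1/eps)
   times as many active jobs as any other schedule.  Put kappa = 1/eps - 1.  For
   a job with [e] units done and [r] units left, the estimate is at least [v]
   iff r >= v and e >= kappa v, and the work it still has to receive while its
   estimate is below [v] is min(r, max(v, v (1 + kappa) - e)).  Let L(v) be the
   sum of these amounts over the jobs of SLF, and R(v) the sum of min(x, c v)
   over the remaining times x of the other schedule.  Then L(v) <= R(v) at all
   times and for all v; for small v > 0 this compares the numbers of active
   jobs, and integrating over time compares the flow times.

   A release preserves L <= R, since it adds min(p, v / eps) to L(v) and
   min(p, c v) to R(v).  Between two releases the inequality is dualized: R is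
   concave with integer slopes, so it suffices that for each natural number k
   the maximum over v of L(v) - k v, as long as it is positive, decreases at
   least at unit speed, while that of R(v) - k v decreases at most at unit speed.
   If the minimum estimate is below the maximizing v, all work reduces L(v).
   Otherwise L(v) = n v with n > k active jobs; while a known job runs, the
   minimum estimate v itself decreases at unit speed, hence so does (n - k) v.

   The online algorithm is obtained by breaking ties between known jobs by
   index.  The resulting rates are constant on the right of every time, so that
   the schedule is determined by what is observed, and it extends from [0, T) to
   a longer interval; a supremum argument makes it global. *)

(** * Accumulated work *)

Section Rates.
Context {R : realType}.
Local Notation mu := (@lebesgue_measure R).
Implicit Types (f g : R -> R) (a b c t u v : R).

Definition is_rate f := measurable_fun [set: R] f /\ forall t, 0 <= f t <= 1.

Definition cumul f t : R := \int[mu]_(s in `[0, t]) f s.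

Lemma is_rate_integrable f (i : interval R) : is_rate f ->
  (mu [set` i] < +oo)%E -> mu.-integrable [set` i] (EFin \o f).
Proof.
move=> [mf bf] fi; apply: measurable_bounded_integrable => //.
  exact: measurable_funS mf.
exists 1; split; first exact: num_real.
move=> M M1 x _ /=; case/andP: (bf x) => f0 f1.
by rewrite ger0_norm// (le_trans f1)// ltW.
Qed.

Lemma is_rate_integrable_cc f a b : is_rate f -> mu.-integrable `[a, b] (EFin \o f).
Proof.
move=> rf; apply: is_rate_integrable => //.
by rewrite lebesgue_measure_itv/=; case: ifP => _; rewrite ?ltry.
Qed.

Lemma cumulB f a b : is_rate f -> 0 <= a -> a <= b ->
  cumul f b - cumul f a = \int[mu]_(s in `]a, b[) f s.
Proof.
move=> rf a0 ab; rewrite /cumul Rintegral_itvB//; last first.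
  exact: is_rate_integrable_cc.
rewrite -Rintegral_itv_bndo_bndc//.
apply: is_rate_integrable => //.
by rewrite lebesgue_measure_itv/=; case: ifP => _; rewrite ?ltry.
Qed.

Lemma cumul_le0 f t : t <= 0 -> cumul f t = 0.
Proof.
rewrite le_eqVlt => /orP[/eqP ->|t0]; first by rewrite /cumul set_itv1 Rintegral_set1.
by rewrite /cumul set_itv_ge ?Rintegral_set0// bnd_simp -ltNge.
Qed.

Lemma Rintegral_cst_oo a b c : a <= b -> \int[mu]_(s in `]a, b[) c = c * (b - a).
Proof.
move=> ab; rewrite Rintegral_cst//; congr (_ * _).
have mE : mu `]a, b[ = (b - a)%:E.
  rewrite lebesgue_measure_itv/= lte_fin; case: ltP => //= ba.
  by congr EFin; lra.
rewrite -[b - a]/(fine (b - a)%:E) -mE.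
by [].
Qed.

Lemma cumulB_cst f a b c : is_rate f -> 0 <= a -> a <= b ->
  (forall s, a < s < b -> f s = c) -> cumul f b - cumul f a = c * (b - a).
Proof.
move=> rf a0 ab fc; rewrite cumulB// -Rintegral_cst_oo//.
by apply: eq_Rintegral => s; rewrite inE/= in_itv/= => /fc.
Qed.

Lemma is_rate_integrable_oo f a b : is_rate f -> mu.-integrable `]a, b[ (EFin \o f).
Proof.
move=> rf; apply: is_rate_integrable => //.
by rewrite lebesgue_measure_itv/=; case: ifP => _; rewrite ?ltry.
Qed.

Lemma is_rate_cst c : 0 <= c <= 1 -> is_rate (fun=> c).
Proof. by move=> c01; split => //; exact: measurable_cst. Qed.

Lemma cumul_mono f a b : is_rate f -> a <= b -> cumul f a <= cumul f b.
Proof.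
move=> rf ab; case: (leP 0 a) => [a0|/ltW a0].
  rewrite -subr_ge0 cumulB//; apply: Rintegral_ge0 => s _.
  by case: rf => _ /(_ s) /andP[].
by rewrite (cumul_le0 _ _ a0); apply: Rintegral_ge0 => s _; case: rf => _ /(_ s) /andP[].
Qed.

Lemma cumul_ge0 f t : is_rate f -> 0 <= cumul f t.
Proof. by move=> rf; apply: Rintegral_ge0 => s _; case: rf => _ /(_ s) /andP[]. Qed.

Lemma cumulB_le f a b : is_rate f -> a <= b -> cumul f b - cumul f a <= b - a.
Proof.
move=> rf ab.
have key u v : 0 <= u -> u <= v -> cumul f v - cumul f u <= v - u.
  move=> u0 uv; rewrite cumulB// -[leRHS]mul1r -Rintegral_cst_oo//.
  apply: le_Rintegral => //; first exact: is_rate_integrable_oo.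
    by apply: (@is_rate_integrable_oo (fun=> 1)); apply: is_rate_cst; rewrite lexx ler01.
  by move=> s _; case: rf => _ /(_ s) /andP[].
case: (leP 0 a) => [a0|a0]; first exact: key.
case: (leP 0 b) => [b0|b0]; last first.
  by rewrite (cumul_le0 f a (ltW a0)) (cumul_le0 f b (ltW b0)); lra.
have := key 0 b (lexx 0) b0; rewrite (cumul_le0 f 0 (lexx 0)) (cumul_le0 f a (ltW a0)).
by move=> /le_trans; apply; lra.
Qed.

Lemma cumul_lipschitz f a b : is_rate f -> `|cumul f b - cumul f a| <= `|b - a|.
Proof.
move=> rf; wlog ab : a b / a <= b => [h|].
  by case: (leP a b) => [/h//|/ltW /h]; rewrite distrC (distrC a).
rewrite !ger0_norm ?subr_ge0//; first exact: cumulB_le.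
exact: cumul_mono.
Qed.

Lemma cumul_continuous f : is_rate f -> continuous (cumul f).
Proof.
move=> rf x; apply/cvgrPdist_lt => e e0; near=> y.
apply: (le_lt_trans (cumul_lipschitz _ _ _ rf)).
near: y; exact: (@cvgr_dist_lt _ _ _ _ _ id x).
Unshelve. all: by end_near. Qed.

Lemma cumul_IVT f a b y : is_rate f -> a <= b -> cumul f a <= y <= cumul f b ->
  exists2 u, a <= u <= b & cumul f u = y.
Proof.
move=> rf ab yab.
have [|u] := @IVT R (cumul f) a b y ab (continuous_subspaceT (cumul_continuous f rf)).
  rewrite min_l ?max_r//; exact: cumul_mono.
by rewrite in_itv/= => uab <-; exists u.
Qed.

(* Every barrier argument below is an instance: the accumulated work cannot
   traverse a nondegenerate band in which the rate vanishes. *)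
Lemma cumul_crossing {f a b c d} : is_rate f -> 0 <= a -> a <= b ->
  cumul f a <= c -> c < d -> d <= cumul f b ->
  exists u, [/\ a < u < b, 0 < f u & c <= cumul f u <= d].
Proof.
move=> rf a0 ab ac cd db.
have [z2 /andP[az2 z2b] z2d] : exists2 u, a <= u <= b & cumul f u = d.
  by apply: cumul_IVT => //; rewrite db andbT; lra.
have [z1 /andP[az1 z12] z1c] : exists2 u, a <= u <= z2 & cumul f u = c.
  by apply: cumul_IVT => //; rewrite ac z2d/= ltW.
apply: contrapT => /forallNP none.
have := @cumulB_cst f z1 z2 0 rf (le_trans a0 az1) z12; rewrite mul0r z1c z2d.
suff: forall s, z1 < s < z2 -> f s = 0 by move=> /[swap] /[apply]; lra.
move=> s /andP[z1s sz2].
case: (rf) => _ /(_ s) /andP[f0 _]; apply: le_anti; rewrite f0 andbT leNgt.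
apply/negP => fs; apply: (none s); split => //; first by apply/andP; split; lra.
by rewrite -z1c -[d]z2d !cumul_mono ?ltW.
Qed.

Lemma cumul_sum (I : Type) (r : seq I) (F : I -> R -> R) t :
  (forall i, is_rate (F i)) ->
  \sum_(i <- r) cumul (F i) t = cumul (fun s => \sum_(i <- r) F i s) t.
Proof.
move=> rF; rewrite /cumul.
(* Additivity of the integral needs integrable summands, so integrability of the partial sums is
   carried through the induction. *)
suff : mu.-integrable `[0, t] (EFin \o (fun s => \sum_(i <- r) F i s)) /\
  \sum_(i <- r) \int[mu]_(s in `[0, t]) F i s =
  \int[mu]_(s in `[0, t]) (\sum_(i <- r) F i s) by case.
elim: r => [|i r [ih1 ih2]].
  under [X in _.-integrable _ (_ \o X)]eq_fun do rewrite big_nil.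
  under eq_Rintegral do rewrite big_nil.
  rewrite big_nil Rintegral_cst// mul0r; split => //.
  by apply: (is_rate_integrable_cc (fun=> 0)); apply: is_rate_cst; rewrite lexx ler01.
under [X in _.-integrable _ (_ \o X)]eq_fun do rewrite big_cons.
under [X in _ = X]eq_Rintegral do rewrite big_cons.
rewrite big_cons ih2 RintegralD//; last exact: is_rate_integrable_cc.
split => //; have -> : EFin \o (fun s => F i s + \sum_(j <- r) F j s) =
    ((EFin \o F i) \+ (EFin \o (fun s => (\sum_(j <- r) F j s)%R)))%E by [].
by apply: integrableD => //; exact: is_rate_integrable_cc.
Qed.

Lemma is_rate_sum (I : Type) (r : seq I) (F : I -> R -> R) :
  (forall i, is_rate (F i)) -> (forall t, \sum_(i <- r) F i t <= 1) ->
  is_rate (fun t => \sum_(i <- r) F i t).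
Proof.
move=> rF F1; split; first by apply: measurable_sum => i; exact: (rF i).1.
by move=> t; rewrite F1 andbT sumr_ge0// => i _; case/andP: ((rF i).2 t).
Qed.

Lemma cumulB_sum (I : Type) (r : seq I) (F : I -> R -> R) a b :
  (forall i, is_rate (F i)) ->
  \sum_(i <- r) (cumul (F i) b - cumul (F i) a) =
  cumul (fun s => \sum_(i <- r) F i s) b - cumul (fun s => \sum_(i <- r) F i s) a.
Proof. by move=> rF; rewrite sumrB !cumul_sum. Qed.

(* By Lebesgue differentiation, equal increments force equal rates almost
   everywhere, and equal rates of product zero vanish. *)
Lemma cumul_alternating f g a b : is_rate f -> is_rate g -> 0 <= a -> a <= b ->
  (forall s, a < s < b -> f s * g s = 0) ->
  (forall s, a <= s <= b -> cumul f s - cumul f a = cumul g s - cumul g a) ->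
  cumul f b = cumul f a.
Proof.
move=> rf rg a0 ab fg0 fgE.
have loc h : is_rate h -> {ae mu, forall x, 0 < x ->
    derivable (cumul h) x 1 /\ derive1 (cumul h) x = h x}.
  move=> rh; have lh : locally_integrable [set: R] h.
    split; [exact: rh.1|exact: openT|move=> K _ cK].
    have /integrableP[] // : mu.-integrable K (EFin \o h).
    apply: measurable_bounded_integrable.
    - exact: compact_measurable.
    - exact: compact_finite_measure.
    - exact: measurable_funS rh.1.
    - exists 1; split; first exact: num_real.
      move=> M M1 x _ /=; case/andP: (rh.2 x) => h0 h1.
      by rewrite ger0_norm// (le_trans h1)// ltW.
  have := @FTC1 R h (BLeft 0) (fun y => is_rate_integrable_cc h 0 y rh) lh.
  apply: filterS; first exact: (ae_filter_ringOfSetsType mu).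
  by move=> x /= Hx x0; apply: Hx; rewrite lte_fin.
have f0 : (EFin \o f) = cst 0%E %[ae mu in (`]a, b[%classic : set R)].
  have := loc f rf; have := loc g rg; apply: filterS2.
    exact: (ae_filter_ringOfSetsType mu).
  move=> x /= Hg Hf.
  rewrite in_itv/= => /andP[ax xb].
  have x0 : 0 < x by exact: le_lt_trans ax.
  have [df fE] := Hf x0; have [dg gE] := Hg x0.
  have fgx : f x = g x.
    rewrite -fE -gE !derive1E.
    (* Near [x] the two accumulated works differ by a constant, so their derivatives at [x]
       agree. *)
    rewrite (@near_eq_derive _ _ _ _ (fun y => cumul g y + (cumul f a - cumul g a))) ?oner_neq0//.
      by rewrite deriveD// derive_cst addr0.
    near=> y; rewrite addrC -addrA.
    suff /fgE : a <= y <= b by lra.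
    apply/andP; split; near: y.
      by apply: filterS (lt_nbhsr ax) => z /ltW.
    by apply: filterS (lt_nbhsl xb) => z /ltW.
  have := fg0 x; rewrite ax xb => /(_ isT) /eqP.
  by rewrite -fgx mulf_eq0 orbb => /eqP ->.
apply/eqP; rewrite -subr_eq0 cumulB// /Rintegral.
rewrite (ae_eq_integral _ _ _ _ _ f0)// ?integral0//.
by apply/measurable_EFinP; apply: measurable_funS rf.1.
Unshelve. all: by end_near. Qed.

End Rates.

(** * Release-free intervals *)

Section ExtremeTimes.
Context {R : realType}.
Implicit Types (P : R -> Prop) (a t : R).

(** The supremum of the times in [a, t] satisfying [P] is approached from the left by such times,
    and the second hypothesis closes [P] under such limits. *)
Lemma last_time P a t : (exists2 u, a <= u <= t & P u) ->
  (forall s, a <= s <= t ->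
     (forall d, 0 < d -> exists u, [/\ s - d < u, a <= u <= s & P u]) -> P s) ->
  exists s, [/\ a <= s <= t, P s & forall u, s < u <= t -> ~ P u].
Proof.
move=> [u0 /andP[au0 u0t] Pu0] clP.
pose A := [set u | a <= u <= t /\ P u].
have A0 : A !=set0 by exists u0; split => //; rewrite au0.
have hA : has_sup A by split => //; exists t => u [/andP[]].
have au : a <= sup A by apply: (le_trans au0); apply: ub_le_sup; [exact: hA.2|split; rewrite ?au0].
have ut : sup A <= t by apply: ge_sup => // u [/andP[]].
exists (sup A); split; first by rewrite au.
- apply: clP => [|d d0]; first by rewrite au.
  have [u [/andP[au' ut'] Pu] du] := sup_adherent d0 hA.
  exists u; split => //; rewrite au'/=; apply: ub_le_sup; first exact: hA.2.
  by split => //; rewrite au'.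
- move=> u /andP[su ut'] Pu.
  have := hA.2; move=> /ub_le_sup/(_ u); rewrite leNgt su => H.
  have //: false by apply: H; split => //; rewrite ut' (le_trans au (ltW su)).
Qed.

(** Time reversal of [last_time]; closure is now under limits from the right. *)
Lemma first_time P a t : (exists2 u, a <= u <= t & P u) ->
  (forall s, a <= s <= t ->
     (forall d, 0 < d -> exists u, [/\ u < s + d, s <= u <= t & P u]) -> P s) ->
  exists s, [/\ a <= s <= t, P s & forall u, a <= u < s -> ~ P u].
Proof.
move=> [u0 au0 Pu0] clP.
have [|s|s [ats Ps sP]] := @last_time (fun u => P (- u)) (- t) (- a).
- by exists (- u0); rewrite ?opprK//; lra.
- move=> ast h; apply: clP; first by lra.
  move=> d /h[u [su tu Pu]]; exists (- u); split => //; lra.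
- exists (- s); split => //; first by lra.
  by move=> u aus; rewrite -(opprK u); apply: sP; lra.
Qed.

End ExtremeTimes.

(** * The work of a single job below a level *)

Section Levels.
Local Opaque cumul.
Context {R : realType} {kappa : R}.
Context (kappa_ge0 : 0 <= kappa).
Implicit Types (f : R -> R) (v p e : R).

(* The work that a job of size [p], of which [e] is done, still needs while its
   estimate is at most [v]. *)
Definition level_work v p e : R :=
  Num.min (p - e) (Num.max v (v * (1 + kappa) - e)).

(** As a function of the work done, the level work has slope -1 except on the band from kappa v to p
    - v, where it is constant. The last hypothesis says that [x, y] meets this band in at most a
    point. *)
Lemma level_work_slope v p x y : x <= y -> 0 <= kappa * v ->
  Num.min y (p - v) <= Num.max x (kappa * v) ->
  level_work v p x = level_work v p y + (y - x).
Proof.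
move=> xy k0; have vE : v * (1 + kappa) = v + kappa * v by ring.
rewrite /level_work vE; set k := kappa * v in k0 *.
have full z : p - v <= z \/ p - v <= k ->
    Num.min (p - z) (Num.max v (v + k - z)) = p - z.
  by move=> h; rewrite min_l// le_max; case: h => h; apply/orP; [left|right]; lra.
rewrite ge_min !le_max -!orbA => /or4P[yx|yk|px|pk].
- by have -> : x = y; lra.
- rewrite (@max_r _ _ _ (v + k - x)) ?(@max_r _ _ _ (v + k - y)); try lra.
  case: (leP p (v + k)) => pvk.
    by rewrite !min_l; lra.
  by rewrite !min_r; lra.
- by rewrite !full; [lra|left; lra|left; lra].
- by rewrite !full; [lra|right; lra|right; lra].
Qed.

(** A job that runs only while its estimate is at most [v] cannot traverse the band on which the
    level work is constant, so all of its work counts. *)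
Lemma level_work_drop f v p a b : is_rate f -> 0 <= a -> a <= b ->
  cumul f b <= p -> 0 <= v ->
  (forall u, a < u < b -> 0 < f u ->
     p - cumul f u <= v \/ cumul f u <= kappa * v) ->
  level_work v p (cumul f a) = level_work v p (cumul f b) + (cumul f b - cumul f a).
Proof.
move=> rf a0 ab ebp v0 low.
have eab := cumul_mono f a b rf ab.
have kv0 : 0 <= kappa * v by exact: mulr_ge0.
have [gap|gap] := leP (Num.min (cumul f b) (p - v)) (Num.max (cumul f a) (kappa * v)).
  exact: level_work_slope.
set c := Num.max _ _ in gap; set d := Num.min _ _ in gap.
have ca : cumul f a <= c by rewrite le_max lexx.
have db : d <= cumul f b by rewrite ge_min lexx.
have ck : kappa * v <= c by rewrite le_max lexx orbT.
have dp : d <= p - v by rewrite ge_min lexx orbT.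
(* The middle third of the gap lies strictly inside the band. *)
have [u [aub fu]] : exists u, [/\ a < u < b, 0 < f u &
    (2 * c + d) / 3 <= cumul f u <= (c + 2 * d) / 3].
  by apply: cumul_crossing => //; move: ca db gap; clear; lra.
by move=> eu; have [] := low u aub fu; move: eu gap ck dp; clear; lra.
Qed.

Lemma level_work_high v p e : v <= p - e -> kappa * v <= e -> level_work v p e = v.
Proof.
move=> vp ke; rewrite /level_work (max_l (_ : _ <= v)); last by lra.
by rewrite min_r.
Qed.

Lemma level_work_done v p : 0 <= v -> level_work v p p = 0.
Proof.
by move=> v0; rewrite /level_work subrr min_l// le_max v0.
Qed.

Lemma level_work0 p e : 0 <= e <= p -> level_work 0 p e = 0.
Proof.
move=> /andP[e0 ep]; rewrite /level_work mul0r max_l; last by lra.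
by rewrite min_r; lra.
Qed.

Lemma level_work_fresh v p : 0 <= v -> level_work v p 0 = Num.min p (v * (1 + kappa)).
Proof.
move=> v0; rewrite /level_work !subr0 max_r// mulrDr mulr1 lerDl.
exact: mulr_ge0.
Qed.

Lemma level_work_ge v p e : v <= p - e -> v <= level_work v p e.
Proof. by move=> vp; rewrite /level_work le_min vp le_max lexx. Qed.

End Levels.

Lemma sum_gt0_ex {R : realDomainType} {I : eqType} (r : seq I) (F : I -> R) :
  0 < \sum_(i <- r) F i -> exists2 i, i \in r & 0 < F i.
Proof.
move=> F0; apply: contrapT => none; move: F0; apply/negP; rewrite -leNgt.
rewrite big_seq; apply: sumr_le0 => i ir; rewrite leNgt; apply/negP => Fi.
by apply: none; exists i.
Qed.

(** * SLF against another schedule on an interval without releases *)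

Section Block.
Local Opaque cumul.
Context {R : realType} {kappa : R} (kappa_ge0 : 0 <= kappa).
Context {J : seq nat} (uniqJ : uniq J).
Context {S : nat -> R -> R} (rateS : forall j, is_rate (S j)).
Context (sumS : forall t, \sum_(j <- J) S j t <= 1).
Context {p : nat -> R} {a b : R} (a_ge0 : 0 <= a).
Local Notation e j t := (cumul (S j) t).
Local Notation r j t := (p j - cumul (S j) t).
Context (r_ge0 : forall j t, j \in J -> t <= b -> 0 <= r j t).

(** A lower bound on the estimates of all active jobs, in a form common to known and unknown jobs;
    it is vacuous when no job is active. *)
Definition high v t := forall j, j \in J -> 0 < r j t -> v <= r j t /\ kappa * v <= e j t.

Definition known_step t := exists i, [/\ i \in J, 0 < r i t,
  forall j, j \in J -> S j t = (j == i)%:R & high (r i t) t].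

(** Estimates are compared after multiplication by [kappa], which avoids a division. Taking j = i
    says that a running job is unknown. *)
Definition unknown_step t := \sum_(j <- J) S j t = 1 /\
  forall i, i \in J -> 0 < S i t -> 0 < r i t /\
    forall j, j \in J -> 0 < r j t -> e i t < kappa * r j t /\ e i t <= e j t.

Context (step : forall t, a <= t < b ->
  (exists2 j, j \in J & 0 < r j t) -> known_step t \/ unknown_step t).

Local Notation L v t := (\sum_(j <- J) level_work (kappa := kappa) v (p j) (e j t)).
Local Notation n t := (count (fun j => 0 < r j t) J).

Ltac lin := clear -kappa_ge0 uniqJ rateS sumS a_ge0 r_ge0 step; lra.

Lemma e_mono j s t : s <= t -> e j s <= e j t.
Proof. exact: cumul_mono. Qed.

Lemma e_lip j s t : s <= t -> e j t - e j s <= t - s.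
Proof. exact: cumulB_le. Qed.

Lemma active_anti j s t : s <= t -> 0 < r j t -> 0 < r j s.
Proof. by move=> st; have := e_mono j _ _ st; lra. Qed.

Lemma inactive_const j s t : j \in J -> s <= t -> t <= b -> ~~ (0 < r j s) -> e j t = e j s.
Proof.
by move=> jJ st tb; have := e_mono j _ _ st; have := r_ge0 j t jJ tb; lra.
Qed.

Lemma step_total t : a <= t < b -> (exists2 j, j \in J & 0 < r j t) ->
  \sum_(j <- J) S j t = 1.
Proof.
move=> atb /(step t atb)[[i [iJ _ Si _]]|[]//].
rewrite (bigD1_seq i)//= Si// eqxx big1_seq ?addr0// => j /andP[ji jJ].
by rewrite Si// (negbTE ji).
Qed.

Lemma total_work s t : a <= s -> s <= t -> t <= b ->
  (forall u, s < u < t -> exists2 j, j \in J & 0 < r j u) ->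
  \sum_(j <- J) (e j t - e j s) = t - s.
Proof.
move=> as_ st tb act; rewrite cumulB_sum//.
rewrite -[RHS]mul1r; apply: cumulB_cst => //; first exact: is_rate_sum.
  exact: le_trans as_.
by move=> u sut; apply: step_total; [lra|exact: act].
Qed.

Lemma high_work v t : 0 <= v -> t <= b -> high v t -> L v t = v * (n t)%:R.
Proof.
move=> v0 tb hv; rewrite -sum1_count natr_sum mulr_sumr.
rewrite [RHS]big_mkcond; apply: eq_big_seq => j jJ.
case: ifPn => [rj|rj].
  by rewrite mulr1; have [? ?] := hv j jJ rj; exact: level_work_high.
have -> : e j t = p j by have := r_ge0 j t jJ tb; lra.
exact: level_work_done.
Qed.

(** Some active job has its estimate below [v] throughout, and SLF runs only jobs of minimum
    estimate at full total speed, so by [level_work_drop] every unit of work reduces the sum. *)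
Lemma low_phase v s t : 0 <= v -> a <= s -> s <= t -> t <= b ->
  (forall u, s < u < t -> ~ high v u) -> L v s = L v t + (t - s).
Proof.
move=> v0 as_ st tb low.
have lowex u : s < u < t -> exists2 j, j \in J &
    0 < r j u /\ (r j u < v \/ e j u < kappa * v).
  move=> /low; apply: contra_notP => none j jJ rj.
  apply/andP/negPn; rewrite negb_and -!ltNge; apply/negP => lowj.
  by apply: none; exists j => //; split => //; apply/orP.
rewrite -(total_work s t)//; last first.
  by move=> u /lowex[j jJ [rj _]]; exists j.
rewrite -big_split/=; apply: eq_big_seq => j jJ.
apply: level_work_drop => //.
- exact: le_trans as_.
- by have := r_ge0 j t jJ tb; lra.
move=> u sut Sju; have [k kJ [rk lowk]] := lowex u sut.
have aub : a <= u < b by lra.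
have [|[i [iJ ri Si hi]]|[_ uS]] := step u aub; first by exists k.
  have ji : j = i.
    by move: Sju; rewrite Si//; case: eqVneq => //=; rewrite ltxx.
  subst j; have [ik ek] := hi k kJ rk; left.
  case: lowk => lowk; first by lra.
  by rewrite leNgt; apply/negP => vi; have := ler_wpM2l kappa_ge0 (ltW vi); lra.
have [rj /(_ k kJ rk)[h1 h2]] := uS j jJ Sju; right.
case: lowk => [/ltW lowk|]; last by lra.
by have := ler_wpM2l kappa_ge0 lowk; lra.
Qed.

(* Once a known job runs, no other job overtakes it, and [cumul_alternating]
   excludes that two tied jobs share the machine; so the whole run is spent on a
   single job of minimum remaining time. *)
Lemma known_run s t v : a <= s -> s < t -> t <= b -> known_step s ->
  (forall j, j \in J -> 0 < r j s -> 0 < r j t) -> high v t ->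
  high (v + (t - s)) s.
Proof.
move=> as_ st tb [i0 [i0J ri0 _ h0]] act hv.
have i0t : 0 < r i0 t by exact: act.
(* A job running as unknown at [u] has received less than kappa times the remaining time of [i0],
   but already at [s] every active job had received at least that much. *)
have known u : s <= u < t -> known_step u.
  move=> sut; have aub : a <= u < b by lra.
  have i0u : 0 < r i0 u by apply: (active_anti i0 u t) => //; lra.
  have [|//|[S1 uS]] := step u aub; first by exists i0.
  have [j jJ Sj] : exists2 j, j \in J & 0 < S j u.
    by apply: sum_gt0_ex; rewrite S1.
  have [rj /(_ i0 i0J i0u)[ji0 _]] := uS j jJ Sj.
  have su : s <= u by lra.
  have [_ /= h1] := h0 j jJ (active_anti j s u su rj).
  have := ler_wpM2l kappa_ge0 (e_mono i0 s u su).
  by have := e_mono j s u su; move: h1 ji0; lin.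
(* A job [y] behind an active job [x] receives nothing until [t], since only a job of minimum
   remaining time runs. *)
have front x y u : x \in J -> y \in J -> s <= u -> u <= t ->
    r x u < r y u -> 0 < r x t -> e y t = e y u.
  move=> xJ yJ su ut rxy rx; apply/eqP.
  rewrite eq_le (e_mono y u t ut) andbT leNgt.
  apply/negP => ey.
  (* The cap is at most half-way to a tie with [x], so [y] would run at [w] with strictly more
     remaining time than [x]. *)
  have [w [uwt Sw /andP[_ ew]]] : exists w, [/\ u < w < t, 0 < S y w &
     e y u <= e y w <= Num.min (e y t) ((e y u + (p y - r x u)) / 2)].
    apply: cumul_crossing => //; first exact: (le_trans a_ge0 (le_trans as_ su)).
      by rewrite lt_min ey/=; move: rxy; lin.
    by rewrite ge_min lexx.
  have wt : s <= w < t by move: su uwt; lin.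
  have [k [kJ rk Sk hk]] := known w wt.
  have yk : y = k.
    by move: Sw; rewrite Sk//; case: eqVneq => //=; rewrite ltxx.
  subst k; have uw : u <= w by case/andP: uwt => /ltW.
  have rxw : 0 < r x w by apply: (active_anti x w t) => //; case/andP: wt => _ /ltW.
  have [+ _] := hk x xJ rxw.
  have := e_mono x u w uw; move: ew rxy; rewrite le_min; lin.
(* Of two jobs active at [t], at most one is processed in between. *)
have alone x y : x \in J -> y \in J -> x != y -> 0 < r x t -> 0 < r y t ->
    e x t = e x s \/ e y t = e y s.
  move=> xJ yJ xy rx ry.
  wlog rxy : x y xJ yJ xy rx ry / r x t <= r y t.
    move=> W; case: (leP (r x t) (r y t)) => [|/ltW]; first exact: W.
    by move/W => /(_ yJ xJ); rewrite eq_sym => /(_ xy ry rx) []; [right|left].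
  case: (eqVneq (e x t) (e x s)) => [|ex]; first by left.
  case: (eqVneq (e y t) (e y s)) => [|ey]; first by right.
  exfalso.
  have leS := ltW st.
  have {}ex : e x s < e x t by rewrite lt_neqAle eq_sym ex e_mono.
  have {}ey : e y s < e y t by rewrite lt_neqAle eq_sym ey e_mono.
  have rle u : s <= u -> u <= t -> r x u <= r y u.
    move=> su ut; rewrite leNgt; apply/negP => ryx.
    have := front y x u yJ xJ su ut ryx ry.
    by have := e_mono y u t ut; move: ryx rxy; lin.
  have rs : r x s = r y s.
    apply/eqP; rewrite eq_le rle//= leNgt; apply/negP => rlt.
    by have := front x y s xJ yJ (lexx _) leS rlt rx; move: ey; lin.
  (* At [z] the remaining time of [x] equals that of [y] at [t]. The two jobs stay tied until [z],
     so [y] has done all its work by then, whereas [cumul_alternating] says that it has done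
     none. *)
  have [z szt ez] : exists2 z, s <= z <= t & e x z = e y t + (p x - p y).
    by apply: cumul_IVT => //; move: rs ey rxy; lin.
  have tie u : s <= u <= z -> r x u = r y u.
    move=> /andP[su uz]; have ut : u <= t by case/andP: szt => _; exact: le_trans.
    apply/eqP; rewrite eq_le rle//= leNgt; apply/negP => rlt.
    have := front x y u xJ yJ su ut rlt rx.
    by have := e_mono x u z uz; move: rlt ez; lin.
  have : e y z = e y s.
    apply: (cumul_alternating (S y) (S x)) => //; [exact: le_trans as_|by case/andP: szt| |].
      move=> u suz; have sut : s <= u < t by move: suz szt; lin.
      have [k [kJ _ Sk _]] := known u sut; rewrite !Sk//.
      by case: (eqVneq y k) => [<-|]; rewrite ?mul0r// (negbTE xy) mulr0.
    move=> u suz; have := tie u suz; move: rs; lin.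
  have : s <= z <= z by rewrite lexx andbT; case/andP: szt.
  by move/tie; move: ez ey; lin.
have leS := ltW st.
have tot : \sum_(j <- J) (e j t - e j s) = t - s.
  apply: total_work => // u sut; exists i0 => //.
  by apply: (active_anti i0 u t) => //; case/andP: sut => _ /ltW.
have [x xJ ex] : exists2 x, x \in J & 0 < e x t - e x s.
  by apply: sum_gt0_ex; rewrite tot subr_gt0.
have rxs : 0 < r x s.
  rewrite ltNge; apply/negP => rx.
  have : ~~ (0 < r x s) by rewrite -leNgt.
  by move/(inactive_const x s t xJ leS tb) => exE; move: ex; rewrite exE subrr ltxx.
have rxt := act x xJ rxs.
have exE : e x t - e x s = t - s.
  rewrite -tot (bigD1_seq x)//= big1_seq ?addr0// => j /andP[jx jJ].
  case: (boolP (0 < r j s)) => [rj|/(inactive_const j s t jJ leS tb) ->]; last by rewrite subrr.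
  have xj : x != j by rewrite eq_sym.
  by have [exE|->] := alone x j xJ jJ xj rxt (act j jJ rj); rewrite ?subrr//; move: ex; rewrite exE subrr ltxx.
have rx0 : r x s <= r i0 s.
  rewrite leNgt; apply/negP => rlt.
  by have := front i0 x s i0J xJ (lexx _) leS rlt i0t; move: ex; lin.
have [vx _] := hv x xJ rxt.
have vi : v + (t - s) <= r i0 s by move: vx exE rx0; lin.
move=> j jJ rj; have [h1 h2] := h0 j jJ rj; split; first exact: le_trans h1.
by apply: le_trans h2; exact: ler_wpM2l.
Qed.

(** If a bound failed, [cumul_crossing] would give a time at which [i] runs although its estimate
    exceeds that of [j]. For the second bound, this argument needs [j] to be idle; if [j] is
    processed too, it is itself unknown whenever it runs, which bounds its work and hence that of
    [i]. *)
Lemma unknown_work_le s t i j : a <= s -> s <= t -> t <= b ->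
  (forall u, s < u < t -> unknown_step u) ->
  i \in J -> j \in J -> e i s < e i t -> 0 < r j t ->
  e i t <= e j t /\ e i t <= kappa * r j t.
Proof.
move=> as_ st tb unk iJ jJ ei rj.
have s0 : 0 <= s by exact: le_trans as_.
have unkE u k : s < u < t -> k \in J -> 0 < S k u ->
    e k u < kappa * r j u /\ e k u <= e j u.
  move=> sut kJ Sk; have [_ /(_ k kJ Sk)[_]] := unk u sut; apply=> //.
  by apply: (active_anti j u t) => //; lra.
have ij : e i t <= e j t.
  rewrite leNgt; apply/negP => lt.
  have [u [sut Si Su]] : exists u, [/\ s < u < t, 0 < S i u &
      (Num.max (e i s) (e j t) + e i t) / 2 <= e i u <= e i t].
    have gap : Num.max (e i s) (e j t) < e i t by rewrite gt_max ei.
    have : e i s <= Num.max (e i s) (e j t) by rewrite le_max lexx.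
    by move=> sm; apply: cumul_crossing => //; move: gap sm; lin.
  have : e j t <= Num.max (e i s) (e j t) by rewrite le_max lexx orbT.
  have [_] := unkE u i sut iJ Si; have ut : u <= t by case/andP: sut => _ /ltW.
  by have := e_mono j u t ut; move: Su lt; lin.
split => //.
have [ej|ej] := eqVneq (e j t) (e j s).
  rewrite leNgt; apply/negP => lt.
  have [u [sut Si Su]] : exists u, [/\ s < u < t, 0 < S i u &
      (Num.max (e i s) (kappa * r j t) + e i t) / 2 <= e i u <= e i t].
    have gap : Num.max (e i s) (kappa * r j t) < e i t by rewrite gt_max ei.
    have : e i s <= Num.max (e i s) (kappa * r j t) by rewrite le_max lexx.
    by move=> sm; apply: cumul_crossing => //; move: gap sm; lin.
  have : kappa * r j t <= Num.max (e i s) (kappa * r j t) by rewrite le_max lexx orbT.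
  have [+ _] := unkE u i sut iJ Si; have su : s <= u by case/andP: sut => /ltW.
  have ut : u <= t by case/andP: sut => _ /ltW.
  have -> : e j u = e j t.
    by have := e_mono j s u su; have := e_mono j u t ut; move: ej; lin.
  move: Su lt; lin.
apply: (le_trans ij); rewrite leNgt; apply/negP => lt.
have {}ej : e j s < e j t by rewrite lt_neqAle eq_sym ej e_mono.
(* With [q] units less than its work at [t], job [j] is exactly at the threshold e = kappa r; beyond
   it, [j] would run although it is known. *)
pose q := (e j t - kappa * r j t) / (1 + kappa).
have k1 : 0 < 1 + kappa by rewrite ltr_wpDr.
have q0 : 0 < q by rewrite divr_gt0// subr_gt0.
have qE : q * (1 + kappa) = e j t - kappa * r j t by rewrite divfK// gt_eqF.
have [u [sut Sj /andP[eu _]]] : exists u, [/\ s < u < t, 0 < S j u &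
    Num.max (e j s) (e j t - q) <= e j u <= e j t].
  apply: cumul_crossing => //; first by rewrite le_max lexx.
  by rewrite gt_max ej ltrBlDr ltrDl.
have : e j t - q <= Num.max (e j s) (e j t - q) by rewrite le_max lexx orbT.
have [+ _] := unkE u j sut jJ Sj.
move=> eju /le_trans/(_ eu); rewrite -(ler_pM2r k1).
by move: eju qE; lin.
Qed.

(** The new level is the maximum of [v] and w = e_i(t) / kappa for some job [i] that was processed.
    Every job that runs has received at most kappa w, so all the work of the run lies below the new
    level. *)
Lemma unknown_run s t v : a <= s -> s < t -> t <= b ->
  (forall u, s <= u < t -> unknown_step u) ->
  (forall j, j \in J -> 0 < r j s -> 0 < r j t) ->
  (exists2 j, j \in J & 0 < r j t) -> 0 <= v -> high v t ->
  exists v', [/\ v <= v', high v' t & L v' s = L v' t + (t - s)].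
Proof.
move=> as_ st tb unk act [j0 j0J rj0] v0 hv.
have leS : s <= t by lra.
have s0 : 0 <= s by exact: le_trans as_.
have unk' u : s < u < t -> unknown_step u by move=> /andP[/ltW su ut]; apply: unk; rewrite su.
have tot : \sum_(j <- J) (e j t - e j s) = t - s.
  apply: total_work => // u sut; exists j0 => //.
  by apply: (active_anti j0 u t) => //; case/andP: sut => _ /ltW.
have [i iJ ei] : exists2 i, i \in J & 0 < e i t - e i s.
  by apply: sum_gt0_ex; rewrite tot subr_gt0.
rewrite subr_gt0 in ei.
have [u [sut Su _]] := cumul_crossing (rateS i) s0 leS (lexx _) ei (lexx _).
have [_ /(_ i iJ Su)[riu /(_ i iJ riu)[eiu _]]] := unk' u sut.
(* The running job [i] satisfies 0 <= e_i < kappa r_i. *)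
have kappa_gt0 : 0 < kappa.
  rewrite lt_neqAle kappa_ge0 andbT; apply/eqP => k0.
  by move: eiu; rewrite -k0 mul0r ltNge cumul_ge0.
have moved_active j : j \in J -> e j s < e j t -> 0 < r j t.
  move=> jJ ej; apply: act => //; case: (boolP (0 < r j s)) => // rj.
  by move: ej; rewrite (inactive_const j s t jJ leS tb rj) ltxx.
have wle j k : j \in J -> k \in J -> e j s < e j t -> 0 < r k t ->
    e j t <= e k t /\ e j t <= kappa * r k t.
  by move=> *; exact: (unknown_work_le s t).
pose w := e i t / kappa; have wE : kappa * w = e i t by rewrite mulrC divfK// gt_eqF.
have hw : high w t.
  move=> j jJ rj; have [h1 h2] := wle i j iJ jJ ei rj; rewrite wE; split => //.
  by rewrite -(ler_pM2l kappa_gt0) wE.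
exists (Num.max v w); split; first by rewrite le_max lexx.
  by case: (leP v w).
have v'0 : 0 <= Num.max v w by rewrite le_max v0.
have ew : e i t <= kappa * Num.max v w.
  by rewrite -wE ler_pM2l// le_max lexx orbT.
rewrite -tot -big_split/=; apply: eq_big_seq => j jJ.
apply: level_work_drop => //; first by rewrite -subr_ge0 r_ge0.
move=> x sxt Sx.
have [/ltW sx /ltW xt] := andP sxt.
have [ej|ej] := eqVneq (e j t) (e j s).
  have [_ /(_ j jJ Sx)[rjx _]] := unk' x sxt.
  have rjt : 0 < r j t by apply: act => //; apply: (active_anti j s x).
  have [_ /(_ j jJ Sx)[_ /(_ i iJ)[]]] := unk' x sxt.
    by apply: (active_anti i x t) => //; exact: moved_active.
  by move=> _ ex; right; apply: (le_trans ex); apply: le_trans ew; exact: e_mono.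
have {}ej : e j s < e j t by rewrite lt_neqAle eq_sym ej e_mono.
have [h1 _] := wle j i jJ iJ ej (moved_active i iJ ei).
by right; apply: le_trans ew; apply: le_trans h1; exact: e_mono.
Qed.

(** Let [tau] be the first time at which all estimates are at least v + (t - tau). From [tau] to [t]
    the raised level yields the gain, because n - k >= 1. Before [tau], known steps are excluded by
    [known_run], and [unknown_run] yields the gain. *)
Lemma busy_block s t v : 0 < v -> a <= s -> s <= t -> t <= b ->
  (forall j, j \in J -> 0 < r j s -> 0 < r j t) -> high v t ->
  exists2 v', v <= v' & forall k : nat, (k < n t)%N ->
    (n t)%:R * v - k%:R * v + (t - s) <= L v' s - k%:R * v'.
Proof.
move=> v0 as_ st tb act hv.
have k1 : 0 < 1 + kappa by rewrite ltr_wpDr.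
have [//||tau [/andP[stau taut] htau before]] :=
    @first_time R (fun u => high (v + (t - u)) u) s t.
- by exists t; rewrite ?lexx ?st// subrr addr0.
- move=> x /andP[sx xt] appr j jJ rj.
  have rjs : 0 < r j s by exact: (active_anti j s x).
  split; apply/ler_addgt0Pr => d d0.
    have [u [ud /andP[xu ut] hu]] := appr d d0.
    have [|+ _] := hu j jJ; first by apply: (active_anti j u t) => //; exact: act.
    by have := e_mono j x u xu; move: ud; lin.
  (* From [x] to [u] the work grows by at most u - x, and kappa times the level falls by kappa (u -
     x). *)
  have [|u [ud /andP[xu ut] hu]] := appr (d / (1 + kappa)); first by rewrite divr_gt0.
  have [|_] := hu j jJ; first by apply: (active_anti j u t) => //; exact: act.
  have := e_lip j x u xu.
  have : (u - x) * (1 + kappa) <= d by rewrite -ler_pdivlMr//; move: ud; lin.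
  by lin.
have nE u : s <= u -> u <= t -> n u = n t.
  move=> su ut; apply: eq_in_count => j jJ; apply/idP/idP => [rj|].
    by apply: act => //; apply: (active_anti j s u).
  exact: active_anti.
have tau0 : 0 <= v + (t - tau) by lra.
have finish v' : v + (t - tau) <= v' -> high v' tau -> L v' s = L v' tau + (tau - s) ->
    exists2 v', v <= v' & forall k : nat, (k < n t)%N ->
    (n t)%:R * v - k%:R * v + (t - s) <= L v' s - k%:R * v'.
  move=> vv' hv' LE; exists v'; first by lra.
  move=> k kn; rewrite LE high_work//; [|exact: le_trans vv'|exact: le_trans tb].
  rewrite nE//.
  have kn1 : (1 : R) <= (n t)%:R - k%:R by rewrite lerBrDr nat1r ler_nat.
  have : ((n t)%:R - k%:R) * (v + (t - tau)) <= ((n t)%:R - k%:R) * v'.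
    by rewrite ler_pM2l//; lra.
  have : 1 * (t - tau) <= ((n t)%:R - k%:R) * (t - tau) by rewrite ler_wpM2r//; lra.
  lra.
have [stauE|stau'] := eqVneq s tau.
  by apply: (finish (v + (t - tau))) => //; rewrite -stauE subrr addr0.
have {}stau' : s < tau by rewrite lt_neqAle stau'.
case: (boolP (has (fun j => 0 < r j t) J)) => [/hasP[j0 j0J rj0]|none]; last first.
  exists v => // k; suff -> : n t = 0%N by [].
  by apply/eqP; rewrite -leqn0 leqNgt -has_count.
have unk u : s <= u < tau -> unknown_step u.
  move=> sut; have aub : a <= u < b by lra.
  have [|kn|//] := step u aub.
    exists j0 => //; apply: (active_anti j0 u t) => //.
    by move: sut taut; lin.
  have ust : s <= u by case/andP: sut.
  exfalso; apply: (before u sut); apply: known_run => //.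
  - exact: le_trans ust.
  - by move: sut taut; lin.
  - by move=> j jJ rj; apply: act => //; exact: (active_anti j s u).
have act' j : j \in J -> 0 < r j s -> 0 < r j tau.
  by move=> jJ rj; apply: (active_anti j tau t) => //; exact: act.
have act0 : exists2 j, j \in J & 0 < r j tau.
  by exists j0 => //; exact: (active_anti j0 tau t).
have taub : tau <= b by lra.
have [v' [vv' hv' LE]] := unknown_run s tau _ as_ stau' taub unk act' act0 tau0 htau.
exact: (finish v').
Qed.

(** Time is traced backwards by induction on the number of completions since [a]: first a phase with
    some estimate below [v], then a stretch without completions, where [busy_block] changes the
    level to v', then a short phase below v' just before a completion. *)
Lemma level_gain (k : nat) t v : a <= t -> t <= b -> 0 <= v ->
  0 < L v t - k%:R * v ->
  exists2 v', 0 <= v' & L v t - k%:R * v + (t - a) <= L v' a - k%:R * v'.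
Proof.
have [m] := ubnP (n a - n t); elim: m t v => // m IH t v mt at_ tb v0 pos.
have {}v0 : 0 < v.
  rewrite lt_neqAle v0 andbT; apply/eqP => vE; move: pos; rewrite -vE mulr0 subr0.
  rewrite big_seq big1 ?ltxx// => j jJ; apply: level_work0.
  by rewrite cumul_ge0//=; have := r_ge0 j t jJ tb; lra.
have [[u0 u0t hu0]|nohigh] := pselect (exists2 u, a <= u <= t & high v u); last first.
  exists v; first exact: ltW.
  rewrite (low_phase v a t)//; [lra|exact: ltW|].
  by move=> u aut hu; apply: nohigh; exists u => //; lra.
have [||s [/andP[as_ st] hs after]] := @last_time R (high v) a t.
- by exists u0.
- move=> s /andP[as_ st] appr j jJ rj.
  split; apply/ler_addgt0Pr => d d0.
    have [u [ud /andP[au us] hu]] := appr d d0.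
    have [|+ _] := hu j jJ; first exact: (active_anti j u s).
    by have := e_lip j u s us; lra.
  have [u [ud /andP[au us] hu]] := appr d d0.
  have [|_] := hu j jJ; first exact: (active_anti j u s).
  by have := e_mono j u s us; lra.
have sb : s <= b by lra.
have Ls : L v s = L v t + (t - s).
  apply: low_phase => //; first exact: ltW.
  by move=> u sut; apply: after; lra.
(* At [s] the sum is n(s) v, and it still exceeds k v. *)
have kn : (k < n s)%N.
  rewrite -(ltr_nat R) -(ltr_pM2r v0).
  by move: pos st Ls; rewrite (high_work v s)//; [lin|exact: ltW].
(* [a0] is the earliest time from which no active job finishes until [s]. *)
have [||a0 [/andP[aa0 a0s] acta0 before]] :=
    @first_time R (fun u => forall j, j \in J -> 0 < r j u -> 0 < r j s) a s.
- by exists s => //; rewrite as_ lexx.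
- move=> x /andP[ax xs] appr j jJ rj.
  have [u [ud /andP[xu us] hu]] := appr _ rj; apply: hu => //.
  by have := e_lip j x u xu; move: ud; lin.
have [v' vv' gain] := busy_block a0 s v v0 aa0 a0s sb acta0 hs.
have {}gain := gain k kn.
have LvE : L v t - k%:R * v + (t - s) = (n s)%:R * v - k%:R * v.
  by move: Ls; rewrite (high_work v s)//; [lin|exact: ltW].
have v'0 : 0 < v' by exact: lt_le_trans vv'.
have [aE|aa0'] := eqVneq a a0.
  by exists v'; [exact: ltW|rewrite aE; move: gain LvE; lin].
have {}aa0' : a < a0 by rewrite lt_neqAle aa0'.
(* After [u] and before [a0], some active job is due to finish by [a0] and has at most v' / 2 left,
   so [low_phase] applies at level v'. Its completion makes the induction measure decrease. *)
pose u := Num.max a (a0 - v' / 2).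
have au : a <= u by rewrite le_max lexx.
have ua0 : u < a0 by rewrite gt_max aa0' ltrBlDr ltrDl divr_gt0.
have uv' : a0 - v' / 2 <= u by rewrite le_max lexx orbT.
have gone x : a <= x < a0 -> exists2 j, j \in J & 0 < r j x /\ r j a0 = 0.
  move=> /before; apply: contra_notP => none j jJ rj.
  rewrite ltNge; apply/negP => rs; apply: none; exists j => //; split => //.
  have := r_ge0 j a0 jJ (le_trans a0s sb).
  rewrite le_eqVlt => /orP[/eqP//|ra0].
  by have := acta0 j jJ ra0; rewrite ltNge rs.
have Lu : L v' u = L v' a0 + (a0 - u).
  apply: low_phase => //; [exact: ltW|exact: ltW|exact: le_trans sb|].
  move=> x /andP[ux xa0] hx; have [|j jJ [rjx rja]] := gone x.
    by rewrite xa0 (le_trans au (ltW ux)).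
  have [+ _] := hx j jJ rjx; have := e_lip j x a0 (ltW xa0).
  by move: rja uv' ux v'0; lin.
have nts : (n t <= n a0)%N.
  by apply: sub_count => j; apply: active_anti; exact: le_trans st.
have nua : (n a0 < n u)%N.
  have [|j jJ [rju rja]] := gone u; first by rewrite au.
  rewrite -!size_filter; apply: (@leq_trans (size (j :: [seq j <- J | 0 < r j a0]))) => //.
  apply: uniq_leq_size.
    by rewrite /= filter_uniq// andbT mem_filter rja ltxx.
  move=> i; rewrite inE !mem_filter => /predU1P[->|/andP[ri ->]].
    by rewrite jJ rju.
  by rewrite andbT; apply: (active_anti i u a0) => //; exact: ltW.
have nau : (n u <= n a)%N.
  by apply: sub_count => j; apply: active_anti.
have mu : (n a - n u < m)%N by move: mt nts nua nau; clear -kappa_ge0 uniqJ rateS sumS a_ge0 r_ge0 step; lia.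
have pos' : 0 < L v' u - k%:R * v'.
  by move: pos st a0s ua0 Lu gain LvE; lin.
have [v'' v''0 gain'] := IH u v' mu au (ltW (lt_le_trans ua0 (le_trans a0s sb))) (ltW v'0) pos'.
by exists v'' => //; move: gain' Lu gain LvE; lin.
Qed.

Context {O : nat -> R -> R} (rateO : forall j, is_rate (O j)).
Context (sumO : forall t, \sum_(j <- J) O j t <= 1).

(* The right-hand side is concave in [v] and its slope [k] at [v] is a natural
   number; [level_gain] for this [k] carries a violation at [b] back to [a]. *)
Lemma block_domination (c : nat) : a <= b ->
  (forall v, 0 <= v -> L v a <=
     \sum_(j <- J) Num.min (Num.max 0 (p j - cumul (O j) a)) (c%:R * v)) ->
  forall v, 0 <= v -> L v b <=
     \sum_(j <- J) Num.min (Num.max 0 (p j - cumul (O j) b)) (c%:R * v).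
Proof.
move=> ab dom v v0.
pose x (j : nat) (t : R) : R := Num.max 0 (p j - cumul (O j) t).
pose Rw v t := \sum_(j <- J) Num.min (x j t) (c%:R * v).
rewrite -/(Rw v b) leNgt; apply/negP => lt.
(* The right derivative of [Rw] at [v]: each job whose term is not yet capped by its remaining time
   contributes [c]. *)
pose k := (\sum_(j <- J) (if (c%:R * v < x j b)%R then c else 0))%N.
have concave v' : 0 <= v' -> Rw v' b <= Rw v b + k%:R * (v' - v).
  move=> v'0; rewrite natr_sum mulr_suml -big_split/=; apply: ler_sum => j _.
  case: (ltP (c%:R * v) (x j b)) => xv; last by rewrite mul0r addr0 ge_min lexx.
  by rewrite ge_min; apply/orP; right; move: xv; lin.
have Rw0 : 0 <= Rw 0 b.
  by apply: sumr_ge0 => j _; rewrite mulr0 le_min le_max lexx.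
(* The tangent bound at 0 gives k v <= Rw v b, so the violation makes the excess of L over k v
   positive. *)
have [|v' v'0 gain] := level_gain k b v ab (lexx b) v0.
  by have := concave 0 (lexx 0); move: Rw0 lt; lin.
(* The other schedule reduces its remaining times by at most b - a in total. *)
have RwD : Rw v' a <= Rw v' b + (b - a).
  have : \sum_(j <- J) (cumul (O j) b - cumul (O j) a) <= b - a.
    rewrite cumulB_sum//; apply: cumulB_le => //; exact: is_rate_sum.
  rewrite -(lerD2l (Rw v' b)); apply: le_trans; rewrite -big_split/=.
  apply: ler_sum => j _; have h := cumul_mono (O j) a b (rateO j) ab.
  have xab : x j a <= x j b + (cumul (O j) b - cumul (O j) a).
    rewrite /x ge_max -!lerBlDr !le_max; apply/andP; split; apply/orP.
      by left; move: h; lin.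
    by right; lin.
  rewrite -lerBlDr le_min !lerBlDr; apply/andP; split.
    by rewrite ge_min xab.
  by rewrite ge_min; apply/orP; right; rewrite lerDl subr_ge0.
have := concave v' v'0; have := dom v' v'0; rewrite -/(Rw v' a).
by move: gain RwD lt; lin.
Qed.

End Block.

(** * The two minima of SLF *)

Lemma bigmin_ereal_attained {R : realType} (I : eqType) (s : seq I) (P : pred I)
    (F : I -> R) : has P s ->
  exists i, [/\ i \in s, P i & (\big[Order.min/+oo]_(j <- s | P j) (F j)%:E = (F i)%:E)%E].
Proof.
elim: s => //= i s IH; rewrite big_cons; case: ifPn => Pi /=; last first.
  by move=> /IH[k [ks Pk ->]]; exists k; rewrite inE ks orbT.
move=> _; have [/IH[k [ks Pk ->]]|none] := boolP (has P s); last first.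
  exists i; rewrite mem_head; split => //; rewrite big_hasC// min_l//.
  exact: leey.
case: (leP (F i) (F k)) => h.
  by exists i; rewrite mem_head; split => //; rewrite min_l// lee_fin.
by exists k; rewrite inE ks orbT; split => //; rewrite min_r// lee_fin ltW.
Qed.

Section Steps.
Context {R : realType} {eps : R} (heps : 0 < eps <= 1).
Context {I : instance R} {S : schedule R} (rateS : forall j, is_rate (S j)).
Implicit Types (i j k : nat) (t : R).

Definition clairvoyance_gap : R := eps^-1 - 1.
Local Notation kappa := clairvoyance_gap.

Lemma eps_gt0 : 0 < eps. Proof. by case/andP: heps. Qed.

Lemma gapE : eps * kappa = 1 - eps.
Proof. by rewrite /kappa mulrBr mulr1 divff// gt_eqF// eps_gt0. Qed.

Lemma gap_ge0 : 0 <= kappa.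
Proof. by rewrite subr_ge0 invf_ge1 ?eps_gt0//; case/andP: heps. Qed.

(** With p = e + r, the inequality r <= eps p becomes (1 - eps) r <= eps e, and division by [eps]
    leaves kappa r <= e. *)
Lemma revealedE j t :
  revealed eps I S j t = (kappa * remaining I S j t <= processed S j t).
Proof.
have e0 := eps_gt0; have kE := gapE.
rewrite /revealed -(ler_pM2l e0 (kappa * _)) mulrA kE /remaining.
by apply/idP/idP; lra.
Qed.

Lemma activeE j t :
  active I S j t = known eps I S j t || unknown eps I S j t.
Proof. by rewrite /known /unknown; case: active; case: revealed. Qed.

(** An unknown job has 0 <= e < kappa r; this permits cancelling [kappa] in comparisons with unknown
    jobs. *)
Lemma unknown_gap_gt0 j t : unknown eps I S j t -> 0 < kappa.
Proof.
move=> /andP[_]; rewrite revealedE -ltNge => h.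
rewrite lt_neqAle gap_ge0 andbT; apply/eqP => k0; move: h.
by rewrite -k0 mul0r ltNge => /negP; apply; exact: cumul_ge0.
Qed.

Lemma estimate_known j t : known eps I S j t -> estimate eps I S j t = remaining I S j t.
Proof. by rewrite /estimate /unknown => /andP[_ ->]; rewrite andbF. Qed.

Lemma estimate_unknown j t : unknown eps I S j t ->
  kappa * estimate eps I S j t = processed S j t.
Proof.
move=> uj; have k0 := unknown_gap_gt0 j t uj; have e0 := eps_gt0.
rewrite /estimate uj -gapE; field.
by rewrite !gt_eqF.
Qed.

(** The jobs that the first case of SLF may run. Comparisons with unknown jobs are multiplied by
    [kappa], so that neither extended reals nor divisions occur. *)
Definition leads k t : bool := known eps I S k t &&
  all (fun j =>
    (known eps I S j t ==> (remaining I S k t <= remaining I S j t)) &&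
    (unknown eps I S j t ==> (kappa * remaining I S k t <= processed S j t))) (jobs I).

Definition in_front j t : bool := unknown eps I S j t &&
  all (fun i => unknown eps I S i t ==> (processed S j t <= processed S i t)) (jobs I).

Lemma known_jobs j t : known eps I S j t -> j \in jobs I.
Proof. by do 3 case/andP. Qed.

Lemma unknown_jobs j t : unknown eps I S j t -> j \in jobs I.
Proof. by do 3 case/andP. Qed.

Lemma active_jobs j t : active I S j t -> j \in jobs I.
Proof. by do 2 case/andP. Qed.

Lemma min_known_le j t : known eps I S j t ->
  (min_known eps I S t <= (estimate eps I S j t)%:E)%E.
Proof. by move=> kj; apply: ge_bigmin_seq => //; exact: (known_jobs j t). Qed.

Lemma min_unknown_le j t : unknown eps I S j t ->
  (min_unknown eps I S t <= (estimate eps I S j t)%:E)%E.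
Proof. by move=> uj; apply: ge_bigmin_seq => //; exact: (unknown_jobs j t). Qed.

Lemma leadsP k t : reflect
  [/\ known eps I S k t, (estimate eps I S k t)%:E = min_known eps I S t &
      (min_known eps I S t <= min_unknown eps I S t)%E]
  (leads k t).
Proof.
apply: (iffP andP) => [[kk /allP lead]|[kk kmin le]].
  have kE : (estimate eps I S k t)%:E = min_known eps I S t.
    apply/le_anti/andP; split.
      apply: le_bigmin => [|j]; first exact: leey.
      move=> kj; rewrite lee_fin !estimate_known//.
      by have /andP[/implyP/(_ kj)] := lead j (known_jobs j t kj).
    exact: min_known_le.
  split => //; rewrite -kE; apply: le_bigmin => [|j uj]; first exact: leey.
  rewrite lee_fin -(ler_pM2l (unknown_gap_gt0 j t uj)) (estimate_unknown j)//.
  rewrite estimate_known//.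
  by have /andP[_ /implyP/(_ uj)] := lead j (unknown_jobs j t uj).
split => //; apply/allP => j jJ; apply/andP; split; apply/implyP => hj.
  rewrite -!estimate_known// -lee_fin kmin.
  exact: min_known_le.
rewrite -(estimate_unknown j)// -(estimate_known k)//.
apply: ler_wpM2l; first exact: gap_ge0.
rewrite -lee_fin kmin (le_trans le)//.
exact: min_unknown_le.
Qed.

Lemma has_leads t : has (fun j => active I S j t) (jobs I) ->
  has (leads^~ t) (jobs I) = (min_known eps I S t <= min_unknown eps I S t)%E.
Proof.
move=> act; apply/hasP/idP => [[k _ /leadsP[]//]|le].
have [|none] := boolP (has (fun j => known eps I S j t) (jobs I)).
  move/(bigmin_ereal_attained _ _ _ (fun j => estimate eps I S j t)) => [k [kJ kk kE]].
  by exists k => //; apply/leadsP; split.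
(* Without known jobs the left minimum is infinite, whereas an active unknown job makes the right
   one finite. *)
exfalso; have [j jJ] := hasP act; rewrite activeE => /orP[kj|uj].
  by move/hasP: none; apply; exists j.
move: le; rewrite /min_known big_hasC// leye_eq => /eqP.
suff /(bigmin_ereal_attained _ _ _ (fun j => estimate eps I S j t))[k [_ _]] :
  has (fun j => unknown eps I S j t) (jobs I) by rewrite /min_unknown => ->.
by apply/hasP; exists j.
Qed.

Lemma mem_argmin_unknown j t : (j \in argmin_unknown eps I S t) = in_front j t.
Proof.
rewrite !inE; apply/idP/idP => [/and3P[jJ uj /eqP jE]|/andP[uj /allP front]].
  apply/andP; split => //; apply/allP => i iJ; apply/implyP => ui.
  rewrite -(estimate_unknown j)// -(estimate_unknown i)//.
  rewrite ler_pM2l ?(unknown_gap_gt0 j t)// -lee_fin jE.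
  exact: min_unknown_le.
have jJ := unknown_jobs j t uj.
apply/and3P; split => //; apply/eqP/le_anti/andP; split.
  apply: le_bigmin => [|i ui]; first exact: leey.
  rewrite lee_fin -(ler_pM2l (unknown_gap_gt0 j t uj)) !estimate_unknown//.
  exact: (implyP (front i (unknown_jobs i t ui))).
exact: min_unknown_le.
Qed.

Lemma card_argmin_unknown t :
  #|` argmin_unknown eps I S t| = count (in_front^~ t) (jobs I).
Proof.
rewrite -size_filter; apply/perm_size/uniq_perm.
- exact: fset_uniq.
- by rewrite filter_uniq// fset_uniq.
- move=> j; rewrite mem_filter mem_argmin_unknown andb_idr// => /andP[uj _].
  exact: (unknown_jobs j t).
Qed.

Lemma has_in_front t : has (fun j => active I S j t) (jobs I) ->
  ~~ has (leads^~ t) (jobs I) -> has (in_front^~ t) (jobs I).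
Proof.
move=> act none; rewrite has_leads// -ltNge in none.
have : has (fun j => unknown eps I S j t) (jobs I).
  apply/negPn/negP => no; move: none; rewrite /min_unknown big_hasC//.
  by rewrite ltNge leey.
move/(bigmin_ereal_attained _ _ _ (fun j => estimate eps I S j t)) => [j [jJ uj jE]].
by apply/hasP; exists j => //; rewrite -mem_argmin_unknown !inE jJ uj /min_unknown jE eqxx.
Qed.

(* Over known jobs the bounds on the work done follow from those on the
   remaining work, over unknown jobs it is the other way round. *)
Lemma leads_le k j t : leads k t -> active I S j t ->
  remaining I S k t <= remaining I S j t /\ kappa * remaining I S k t <= processed S j t.
Proof.
move=> /andP[_ /allP lead] aj; have /andP[kj uj] := lead j (active_jobs j t aj).
move: (aj); rewrite activeE => /orP[kj'|uj'].
  have le := implyP kj kj'; split => //.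
  case/andP: kj' => _; rewrite revealedE; apply: le_trans.
  by apply: ler_wpM2l => //; exact: gap_ge0.
have le := implyP uj uj'; split => //.
rewrite -(ler_pM2l (unknown_gap_gt0 j t uj')) (le_trans le)// ltW//.
by case/andP: uj' => _; rewrite revealedE -ltNge.
Qed.

Lemma in_front_le i j t : ~~ has (leads^~ t) (jobs I) -> in_front i t ->
  active I S j t ->
  processed S i t < kappa * remaining I S j t /\ processed S i t <= processed S j t.
Proof.
move=> nolead front aj; have /andP[ui /allP le_front] := front.
move: (aj); rewrite activeE => /orP[kj|uj]; last first.
  have le := implyP (le_front j (unknown_jobs j t uj)) uj.
  split => //; apply: (le_lt_trans le).
  by case/andP: uj => _; rewrite revealedE -ltNge.
have act : has (fun j => active I S j t) (jobs I).
  by apply/hasP; exists j => //; exact: (active_jobs j t).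
have lt : processed S i t < kappa * remaining I S j t.
  rewrite -(estimate_unknown i)// ltr_pM2l ?(unknown_gap_gt0 i t)//.
  rewrite -(estimate_known j)// -lte_fin.
  move: front; rewrite -mem_argmin_unknown !inE => /and3P[_ _ /eqP ->].
  rewrite has_leads// -ltNge in nolead; apply: (lt_le_trans nolead).
  exact: min_known_le.
split => //; apply/ltW/(lt_le_trans lt).
by case/andP: kj => _; rewrite revealedE.
Qed.

End Steps.

(** * Flow times *)

Lemma seq_argmax {R : realType} {T : eqType} (s : seq T) (f : T -> R) : s != [::] ->
  exists2 i, i \in s & forall j, j \in s -> f j <= f i.
Proof.
elim: s => // x s IH _; have [->|/IH[i is_ maxi]] := eqVneq s [::].
  by exists x; rewrite ?mem_head// => j; rewrite inE => /eqP ->.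
case: (leP (f x) (f i)) => xi.
  exists i; first by rewrite inE is_ orbT.
  by move=> j; rewrite inE => /predU1P[->//|/maxi].
exists x; first by rewrite mem_head.
by move=> j; rewrite inE => /predU1P[->//|/maxi/le_trans]; apply; exact: ltW.
Qed.

(** Supplies the small level at which active jobs are counted, and the distances to the next event
    after which the rates may change. *)
Lemma pos_lower_bound {R : realType} {T : eqType} (s : seq T) (f : T -> R) :
  exists2 v, 0 < v & forall i, i \in s -> 0 < f i -> v <= f i.
Proof.
elim: s => [|x s [v v0 vs]]; first by exists 1.
have [fx|fx] := ltP 0 (f x); last first.
  exists v => // i; rewrite inE => /predU1P[->|]; last exact: vs.
  by rewrite ltNge fx.
exists (Num.min v (f x)); first by rewrite lt_min v0.
move=> i; rewrite inE ge_min => /predU1P[->|is_ fi]; first by rewrite lexx orbT.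
by rewrite vs.
Qed.

Section Feasible.
Context {R : realType} {I : instance R} {S : schedule R} (feasS : feasible I S).
Implicit Types (j : nat) (t : R).

Lemma feasible_rate j : is_rate (S j).
Proof.
case: feasS => mS S0 S1 Srel; split => // t; rewrite S0/=.
have [jJ|jJ] := boolP (j \in jobs I); last by rewrite Srel// /released (negbTE jJ).
apply: le_trans (S1 t); rewrite (bigD1_seq j)//= ?fset_uniq// lerDl.
by apply: sumr_ge0 => i _.
Qed.

Lemma feasible_sum (P : pred nat) t : \sum_(j <- [seq j <- jobs I | P j]) S j t <= 1.
Proof.
case: feasS => mS S0 S1 Srel; apply: le_trans (S1 t).
by rewrite big_filter [leRHS](bigID P)/= lerDl sumr_ge0.
Qed.

Lemma processed_unreleased j t : t <= release I j -> processed S j t = 0.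
Proof.
move=> tr; rewrite -[processed S j t]/(cumul (S j) t).
have [t0|/ltW t0] := leP t 0; first exact: cumul_le0.
have := @cumulB_cst R (S j) 0 t 0 (feasible_rate j) (lexx 0) t0.
rewrite mul0r (cumul_le0 _ 0)// subr0; apply => s /andP[_ st].
by case: feasS => _ _ _; apply; rewrite /released negb_and -ltNge (lt_le_trans st)// orbT.
Qed.

(** The active times form the interval from release to completion, or a half-line if the job never
    completes; then both sides are infinite. *)
Lemma flow_measure j : j \in jobs I ->
  (completion I S j - (release I j)%:E)%E = lebesgue_measure [set t | active I S j t].
Proof.
move=> jJ; have p0 := proc_gt0 jJ; have r0 := release_ge0 jJ.
have activeP t : active I S j t = (release I j <= t) && (processed S j t < proc I j).
  by rewrite /active /released jJ /remaining subr_gt0.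
have [[t1 [t10 pt1]]|never] := pselect (exists t, 0 <= t /\ proc I j <= processed S j t).
  have [||s [/andP[s0 st1] ps before]] :=
      @first_time R (fun t => proc I j <= processed S j t) 0 t1.
  - by exists t1; rewrite ?t10/=.
  - move=> u /andP[u0 ut1] appr; apply/ler_addgt0Pr => d d0.
    have [w [wd /andP[uw _] pw]] := appr d d0.
    have := cumulB_le (S j) u w (feasible_rate j) uw.
    by move: pw wd; rewrite /processed /cumul; lra.
  have -> : completion I S j = s%:E.
    apply/le_anti/andP; split; first by apply: ereal_inf_lbound; exists s.
    apply: le_ereal_inf_tmp => _ [t [t0 pt] <-]; rewrite lee_fin leNgt; apply/negP => ts.
    by apply: (before t) => //; rewrite t0.
  have rs : release I j < s.
    rewrite ltNge; apply/negP => /processed_unreleased e0.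
    by move: ps; rewrite e0 leNgt p0.
  have -> : [set t | active I S j t] = `[release I j, s[%classic.
    apply/seteqP; split => t /=; rewrite activeP in_itv/= => /andP[rt].
      rewrite rt/= ltNge => /negP pt; rewrite ltNge; apply/negP => st; apply: pt.
      apply: (le_trans ps); exact: (cumul_mono (S j) s t (feasible_rate j) st).
    move=> ts; rewrite rt ltNge; apply/negP; apply: before.
    by rewrite ts (le_trans r0 rt).
  by rewrite lebesgue_measure_itv/= lte_fin rs.
have -> : completion I S j = +oo%E.
  rewrite /completion (_ : [set t | _] = set0) ?image_set0 ?ereal_inf0//.
  by apply/seteqP; split => // t [t0 pt]; apply: never; exists t.
have -> : [set t | active I S j t] = `[release I j, +oo[%classic.
  apply/seteqP; split => t /=; rewrite activeP in_itv/= andbT.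
    by case/andP.
  move=> rt; rewrite rt/= ltNge; apply/negP => pt; apply: never; exists t; split => //.
  exact: le_trans rt.
by rewrite lebesgue_measure_itv/= ltry.
Qed.

Lemma measurable_active j : measurable [set t | active I S j t].
Proof.
have [jJ|jJ] := boolP (j \in jobs I); last first.
  rewrite (_ : [set t | _] = set0)//; apply/seteqP; split => t //=.
  by rewrite /active /released (negbTE jJ).
rewrite (_ : [set t | _] = `[release I j, +oo[ `&` (cumul (S j) @^-1` `]-oo, proc I j[)).
  apply: measurableI; first exact: measurable_itv.
  rewrite -[X in measurable X]setTI.
  have mc : measurable_fun [set: R] (cumul (S j)).
    by apply: continuous_measurable_fun; exact: cumul_continuous (feasible_rate j).
  exact: (mc measurableT _ (measurable_itv _)).
by apply/seteqP; split => t /=;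
  rewrite /active /released jJ /remaining subr_gt0 !in_itv/= andbT => /andP.
Qed.

Lemma active_countE t : (count (fun j => active I S j t) (jobs I))%:R =
  \sum_(j <- jobs I) (\1_[set u | active I S j u] t : R).
Proof.
rewrite -sum1_count natr_sum big_mkcond/=; apply: eq_bigr => j _.
rewrite indicE; case: ifPn => aj; first by rewrite mem_set.
by rewrite memNset//; exact/negP.
Qed.

Lemma measurable_active_count : measurable_fun [set: R]
  (fun t => ((count (fun j => active I S j t) (jobs I))%:R : R)%:E).
Proof.
apply/measurable_EFinP; under eq_fun do rewrite active_countE.
by apply: measurable_sum => j; apply: measurable_indic; exact: measurable_active.
Qed.

(** Summing [flow_measure] over the jobs and exchanging sum and integral reduces the comparison of
    flow times to that of active counts at each time. *)
Lemma total_flow_integral : total_flow I S =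
  (\int[lebesgue_measure]_t
     ((count (fun j => active I S j t) (jobs I))%:R : R)%:E)%E.
Proof.
rewrite /total_flow; under eq_big_seq do rewrite flow_measure//.
transitivity (\sum_(j <- jobs I)
    \int[lebesgue_measure]_t ((\1_[set u | active I S j u] t : R)%:E))%E.
  by apply: eq_bigr => j _; rewrite integral_indic// ?setIT//; exact: measurable_active.
rewrite -ge0_integral_sum//=.
- by apply: eq_integral => t _; rewrite sumEFin active_countE.
- move=> j; apply/measurable_EFinP; apply: measurable_indic; exact: measurable_active.
Qed.

End Feasible.

(** * Local competitiveness of SLF *)

Section Domination.
Context {R : realType} {eps : R} (heps : 0 < eps <= 1).
Context {I : instance R} {S : schedule R} (slfS : is_SLF eps I S).
Implicit Types (i j k : nat) (t : R).
Local Notation kappa := (@clairvoyance_gap R eps).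

Local Notation lead := (@leads R eps I S).
Local Notation front := (@in_front R eps I S).

Let feasS : feasible I S := slfS.1.
Let rateS : forall j, is_rate (S j) := feasible_rate feasS.

Lemma SLF_step t : 0 <= t -> has (fun j => active I S j t) (jobs I) ->
  (exists k, lead k t /\ forall j, S j t = (j == k)%:R) \/
  (~~ has (fun k => lead k t) (jobs I) /\
   forall j, S j t = if front j t
     then (count (fun i => front i t) (jobs I))%:R^-1 else 0).
Proof.
move=> t0 act; have := slfS.2 t t0; rewrite act.
case: ifP => le => [[k [kk kE Sk]]|Sj].
  by left; exists k; split => //; apply/(leadsP heps rateS); split.
right; split; first by rewrite (has_leads heps rateS)// le.
by move=> j; rewrite Sj (mem_argmin_unknown heps rateS) (card_argmin_unknown heps rateS).
Qed.

Lemma SLF_active j t : 0 <= t -> 0 < S j t -> active I S j t.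
Proof.
move=> t0; have [act|none] := boolP (has (fun j => active I S j t) (jobs I)); last first.
  by have := slfS.2 t t0; rewrite (negbTE none) => ->; rewrite ltxx.
have [[k [leadk ->]]|[_ ->]] := SLF_step t t0 act.
  by case: eqVneq => [->|]; rewrite ?ltxx// => _; case/andP: leadk => /andP[].
by case: ifPn => [/andP[/andP[]]|]; rewrite ?ltxx.
Qed.

(** SLF runs only active jobs; an overshoot would force the job to run at a time when its work
    already exceeds [proc I j]. *)
Lemma SLF_remaining_ge0 j t : j \in jobs I -> 0 <= remaining I S j t.
Proof.
move=> jJ; have p0 := proc_gt0 jJ; rewrite subr_ge0 leNgt; apply/negP => lt.
rewrite -[processed S j t]/(cumul (S j) t) in lt.
have [t0|t0] := leP t 0; first by move: lt; rewrite cumul_le0// ltNge (ltW p0).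
have e0 : cumul (S j) 0 = 0 by exact: cumul_le0.
have [u [/andP[u0 _] Su /andP[pu _]]] : exists u, [/\ 0 < u < t, 0 < S j u &
    (proc I j + cumul (S j) t) / 2 <= cumul (S j) u <= cumul (S j) t].
  by apply: cumul_crossing => //; rewrite ?e0 ?(ltW t0)//; lra.
have /andP[_] := SLF_active j u (ltW u0) Su.
by rewrite /remaining -[processed S j u]/(cumul (S j) u); lra.
Qed.

(** No job of [J] arrives after [a], so inside the block activity is a matter of remaining work
    alone, and leaders and front jobs give the two kinds of steps. *)
Lemma SLF_block_step (a b t : R) : 0 <= a -> a <= t < b ->
  (forall j, j \in jobs I -> release I j < b -> release I j <= a) ->
  let J := [seq j <- jobs I | release I j < b] in
  (exists2 j, j \in J & 0 < proc I j - cumul (S j) t) ->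
  @known_step R kappa J S (proc I) t \/ @unknown_step R kappa J S (proc I) t.
Proof.
move=> a0 /andP[at_ tb] rel J [j0 j0J rj0].
have activeE j : j \in J -> active I S j t = (0 < proc I j - cumul (S j) t).
  rewrite mem_filter => /andP[jb jJ]; rewrite /active /released jJ/=.
  by rewrite (le_trans (rel j jJ jb) at_).
have activeJ j : active I S j t -> j \in J.
  by move=> /andP[/andP[jJ rj] _]; rewrite mem_filter jJ (le_lt_trans rj).
have act : has (fun j => active I S j t) (jobs I).
  apply/hasP; exists j0; last by rewrite activeE.
  by move: j0J; rewrite mem_filter => /andP[].
have t0 := le_trans a0 at_.
have [[k [leadk Sk]]|[nolead Sf]] := SLF_step t t0 act; [left|right].
  have ak : active I S k t by case/andP: leadk => /andP[].
  have kJ := activeJ k ak.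
  exists k; split => //; first by rewrite -activeE.
  by move=> j jJ rj; apply: (leads_le heps rateS) => //; rewrite activeE.
split; last first.
  move=> i iJ; rewrite Sf; case: ifPn => [fi _|]; last by rewrite ltxx.
  split; first by rewrite -activeE//; case/andP: fi => /andP[].
  by move=> j jJ rj; apply: (in_front_le heps rateS) => //; rewrite activeE.
have frontJ j : front j t -> j \in J.
  by move=> fj; apply: activeJ; case/andP: fj => /andP[].
under eq_bigr do rewrite Sf.
have -> : count (front^~ t) (jobs I) = count (front^~ t) J.
  rewrite count_filter; apply: eq_count => j /=; rewrite andb_idr//.
  by move=> /frontJ; rewrite mem_filter => /andP[].
have cnt : (0 < count (front^~ t) J)%N.
  have /hasP[i _ fi] := has_in_front heps rateS t act nolead.
  by rewrite -has_count; apply/hasP; exists i => //; exact: frontJ.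
rewrite -big_mkcond/= big_const_seq iter_addr_0 -[LHS]mulr_natr mulVf//.
by rewrite pnatr_eq0 -lt0n.
Qed.


Context {c : nat} (hc : 1 + kappa <= c%:R).
Context {O : schedule R} (feasO : feasible I O).
Let rateO : forall j, is_rate (O j) := feasible_rate feasO.

Definition dominated (J : seq nat) t : Prop := forall v, 0 <= v ->
  \sum_(j <- J) level_work (kappa := kappa) v (proc I j) (cumul (S j) t) <=
  \sum_(j <- J) Num.min (Num.max 0 (proc I j - cumul (O j) t)) (c%:R * v).

Lemma dominated_release t : dominated [seq j <- jobs I | release I j < t] t ->
  dominated [seq j <- jobs I | release I j <= t] t.
Proof.
move=> dom v v0; have := dom v v0; rewrite !big_filter => domv.
rewrite (bigID (fun j => release I j < t))/= [leRHS](bigID (fun j => release I j < t))/=.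
have splitlt (F : nat -> R) : \sum_(j <- jobs I | (release I j <= t) && (release I j < t)) F j =
    \sum_(j <- jobs I | release I j < t) F j.
  by apply: eq_bigl => j; rewrite andb_idl// => /ltW.
rewrite !splitlt; apply: lerD => //; rewrite big_seq_cond [leRHS]big_seq_cond.
apply: ler_sum => j /andP[jJ /andP[jt tj]]; rewrite -leNgt in tj.
rewrite -[cumul (S j) t]/(processed S j t) -[cumul (O j) t]/(processed O j t).
rewrite (processed_unreleased feasS)// (processed_unreleased feasO)// subr0.
have p0 := proc_gt0 jJ.
rewrite level_work_fresh//; last exact: gap_ge0 heps.
rewrite max_r ?(ltW p0)// le_min ge_min lexx/= ge_min; apply/orP; right.
by rewrite mulrC ler_wpM2r.
Qed.

(** Induction on the number of jobs released before [t]: from the latest release time [t1] before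
    [t], the inequality is carried to [t] by [block_domination]. *)
Lemma dominated_before t : dominated [seq j <- jobs I | release I j < t] t.
Proof.
have [m] := ubnP (size [seq j <- jobs I | release I j < t]).
elim: m t => // m IH t; set J := [seq j <- jobs I | _] => sJ.
have [->|Jne] := eqVneq J [::]; first by move=> v v0; rewrite !big_nil.
have [j1 j1J maxj1] := seq_argmax J (release I) Jne.
set t1 := release I j1 in maxj1.
have /andP[t1t j1I] : (t1 < t) && (j1 \in jobs I) by move: j1J; rewrite mem_filter.
have uJ : uniq J by rewrite filter_uniq// fset_uniq.
have domt1 : dominated J t1.
  have -> : J = [seq j <- jobs I | release I j <= t1].
    apply: eq_in_filter => j jI; apply/idP/idP => [jt|/le_lt_trans]; last exact.
    by apply: maxj1; rewrite mem_filter jt.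
  apply: dominated_release; apply: IH; rewrite -ltnS; apply: leq_trans sJ.
  rewrite ltnS; apply: (@leq_trans (size (j1 :: [seq j <- jobs I | release I j < t1]))) => //.
  apply: uniq_leq_size.
    by rewrite /= filter_uniq ?fset_uniq// mem_filter ltxx.
  move=> i; rewrite inE => /predU1P[->//|]; rewrite !mem_filter => /andP[it1 ->].
  by rewrite (lt_trans it1 t1t).
have t10 : 0 <= t1 by exact: release_ge0.
have kappa0 := gap_ge0 heps.
apply: (@block_domination R kappa kappa0 J uJ S rateS (feasible_sum feasS _) (proc I)
  t1 t t10 _ _ O rateO (feasible_sum feasO _) c (ltW t1t) domt1).
- move=> j u; rewrite mem_filter => /andP[_ jI] _.
  exact: (SLF_remaining_ge0 j u jI).
- move=> u uu; apply: SLF_block_step uu _ => // j jI jt.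
  by apply: maxj1; rewrite mem_filter jt.
Qed.

(** At a level [v] below all positive remaining times, each active job of SLF contributes at least
    [v] on the left, and each job of the other schedule at most c v on the right, or nothing if it
    is finished. *)
Lemma active_count_le t :
  (count (fun j => active I S j t) (jobs I) <=
   c * count (fun j => active I O j t) (jobs I))%N.
Proof.
have [v v0 vle] := pos_lower_bound (jobs I) (fun j => remaining I S j t).
have := dominated_release t (dominated_before t) v (ltW v0).
rewrite !big_filter => dom.
rewrite -(ler_nat R) natrM -(ler_pM2r v0).
have cntE (Q : pred nat) : (count Q (jobs I))%:R = \sum_(j <- jobs I) (Q j)%:R :> R.
  by rewrite -sum1_count natr_sum big_mkcond; apply: eq_bigr => j _; case: (Q j).
rewrite cntE mulr_suml mulrAC (cntE (fun j => active I O j t)) mulr_sumr.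
rewrite big_mkcond [leRHS]big_mkcond/= in dom.
apply: le_trans; [|apply: (le_trans dom)]; rewrite big_seq [leRHS]big_seq;
  apply: ler_sum => j jJ.
  have e0 := cumul_ge0 (S j) t (rateS j).
  have r0 := SLF_remaining_ge0 j t jJ.
  rewrite /active /released jJ/=; case: (release I j <= t) => /=; last by rewrite mul0r.
  case: ltP => rj; first by rewrite mul1r; apply: level_work_ge; exact: vle.
  rewrite mul0r /level_work le_min r0/= le_max (ltW v0)//.
rewrite /active /released jJ/=; case: (release I j <= t) => /=; last by rewrite mulr0.
rewrite /remaining -[processed O j t]/(cumul (O j) t).
case: ltP => rj; first by rewrite mulr1 ge_min lexx orbT.
by rewrite mulr0 ge_min lexx.
Qed.

Lemma SLF_flow_le : (total_flow I S <= c%:R%:E * total_flow I O)%E.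
Proof.
rewrite (total_flow_integral feasS) (total_flow_integral feasO).
rewrite -ge0_integralZl//=; last exact: measurable_active_count.
apply: ge0_le_integral => //=.
- exact: measurable_active_count.
- by apply: measurable_funeM; exact: measurable_active_count.
- by move=> t _; rewrite -EFinM lee_fin -natrM ler_nat active_count_le.
Qed.

End Domination.

(** * An online SLF schedule *)

Section Rule.
Context {R : realType} {eps : R} (heps : 0 < eps <= 1).
Implicit Types (I : instance R) (S : schedule R) (i j k : nat) (t : R).
Local Notation kappa := (@clairvoyance_gap R eps).

(** Ties between leaders go to the least index. The rates at [t] depend on [S] only through the work
    done by time [t], so the online schedule is a fixed point of this map. *)
Definition slf_rule I S : schedule R := fun j t =>
  if has (fun k => @leads R eps I S k t) (jobs I) then
    (@leads R eps I S j t &&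
     all (fun i => @leads R eps I S i t ==> (j <= i)%N) (jobs I))%:R
  else if @in_front R eps I S j t
       then (count (fun i => @in_front R eps I S i t) (jobs I))%:R^-1 else 0.

Lemma leads_active I S k t : @leads R eps I S k t -> active I S k t.
Proof. by case/andP => /andP[]. Qed.

Lemma in_front_active I S k t : @in_front R eps I S k t -> active I S k t.
Proof. by case/andP => /andP[]. Qed.

(** Quantifying over all indices instead of the jobs of [I] lets instances with different job sets
    be compared. *)
Lemma leads_allP I S k t : @leads R eps I S k t <->
  known eps I S k t /\ forall j,
    (known eps I S j t -> remaining I S k t <= remaining I S j t) /\
    (unknown eps I S j t -> kappa * remaining I S k t <= processed S j t).
Proof.
split=> [/andP[kk /allP le]|[kk le]].
  split => // j; split => hj.
    by have /andP[/implyP/(_ hj)] := le j (known_jobs j t hj).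
  by have /andP[_ /implyP/(_ hj)] := le j (unknown_jobs j t hj).
apply/andP; split => //; apply/allP => j _; have [h1 h2] := le j.
by apply/andP; split; apply/implyP.
Qed.

Lemma in_front_allP I S k t : @in_front R eps I S k t <->
  unknown eps I S k t /\ forall j,
    unknown eps I S j t -> processed S k t <= processed S j t.
Proof.
split=> [/andP[uk /allP le]|[uk le]].
  by split => // j hj; apply: (implyP (le j (unknown_jobs j t hj))).
by apply/andP; split => //; apply/allP => j _; apply/implyP; exact: le.
Qed.

Lemma least_leader I S t : has (fun k => @leads R eps I S k t) (jobs I) ->
  exists2 k, @leads R eps I S k t & forall j, slf_rule I S j t = (j == k)%:R.
Proof.
move=> ex; have exk : exists k, @leads R eps I S k t.
  by have [k _ lk] := hasP ex; exists k.
have [k lk mink] := ex_minnP exk; exists k => // j.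
rewrite /slf_rule ex; congr (nat_of_bool _)%:R.
apply/andP/eqP => [[lj /allP le]|->]; last first.
  by split => //; apply/allP => i _; apply/implyP; exact: mink.
apply/eqP; rewrite eqn_leq mink// andbT.
exact: (implyP (le k (active_jobs k t (leads_active I S k t lk)))).
Qed.

Lemma slf_rule_ge0 I S j t : 0 <= slf_rule I S j t.
Proof.
rewrite /slf_rule; case: ifP => _; first exact: ler0n.
by case: ifP => _; rewrite ?invr_ge0 ?ler0n.
Qed.

Lemma slf_rule_sum I S t : \sum_(j <- jobs I) slf_rule I S j t <= 1.
Proof.
have [/least_leader[k lk E]|nolead] :=
    boolP (has (fun k => @leads R eps I S k t) (jobs I)).
  under eq_bigr do rewrite E.
  rewrite (bigD1_seq k) ?fset_uniq//=; last first.
    exact: (active_jobs k t (leads_active I S k t lk)).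
  by rewrite eqxx big1 ?addr0// => j /negbTE ->.
rewrite /slf_rule (negbTE nolead) -big_mkcond/= big_const_seq iter_addr_0.
rewrite -[leLHS]mulr_natr; set m := count _ _.
by have [->|m0] := eqVneq m 0%N; [rewrite mulr0 ler01|rewrite mulVf// pnatr_eq0].
Qed.

Lemma slf_rule_inactive I S j t : ~~ active I S j t -> slf_rule I S j t = 0.
Proof.
move=> na; rewrite /slf_rule.
have -> : @leads R eps I S j t = false by apply/negP => /leads_active; apply/negP.
have -> : @in_front R eps I S j t = false by apply/negP => /in_front_active; apply/negP.
by case: ifP.
Qed.

Lemma slf_rule_unreleased I S j t : ~~ released I j t -> slf_rule I S j t = 0.
Proof. by move=> nr; apply: slf_rule_inactive; rewrite /active (negbTE nr). Qed.

(** The rule never looks at the remaining time of an unknown job, which is the reason why it is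
    online. *)
Lemma slf_rule_ext I S I' S' t t' :
  known eps I S ^~ t =1 known eps I' S' ^~ t' ->
  unknown eps I S ^~ t =1 unknown eps I' S' ^~ t' ->
  (forall j, processed S j t = processed S' j t') ->
  (forall j, known eps I S j t -> remaining I S j t = remaining I' S' j t') ->
  forall j, slf_rule I S j t = slf_rule I' S' j t'.
Proof.
move=> kE uE eE rE j.
have lE k : @leads R eps I S k t = @leads R eps I' S' k t'.
  apply/idP/idP => /leads_allP[kk le]; apply/leads_allP.
    split=> [|i]; first by rewrite -kE.
    by have [h1 h2] := le i; rewrite -kE -uE -eE -rE//; split => // ki; rewrite -rE// h1.
  rewrite -kE in kk; split=> [//|i].
  have [h1 h2] := le i; rewrite rE//; split => hi; first by rewrite rE// h1// -kE.
  by rewrite eE h2// -uE.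
have fE k : @in_front R eps I S k t = @in_front R eps I' S' k t'.
  apply/idP/idP => /in_front_allP[uk le]; apply/in_front_allP.
    by split=> [|i]; [rewrite -uE|rewrite -uE -!eE; exact: le].
  by split=> [|i]; [rewrite uE|rewrite uE !eE; exact: le].
have hasE (P P' : pred nat) : P =1 P' -> (forall k, P k -> k \in jobs I) ->
    (forall k, P' k -> k \in jobs I') ->
    has P (jobs I) = has P' (jobs I') /\ count P (jobs I) = count P' (jobs I').
  move=> PP' PI PI'.
  have cE : count P (jobs I) = count P' (jobs I').
    rewrite -!size_filter; apply/perm_size/uniq_perm; rewrite ?filter_uniq ?fset_uniq//.
    move=> k; rewrite !mem_filter PP'; case P'k: (P' k) => //=.
    by rewrite PI ?PI' ?PP'.
  by rewrite !has_count cE.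
have [hE _] := hasE _ _ lE (fun k lk => active_jobs k t (leads_active I S k t lk))
  (fun k lk => active_jobs k t' (leads_active I' S' k t' lk)).
have [_ cE] := hasE _ _ fE (fun k lk => active_jobs k t (in_front_active I S k t lk))
  (fun k lk => active_jobs k t' (in_front_active I' S' k t' lk)).
have [ex|nolead] := boolP (has (fun k => @leads R eps I S k t) (jobs I)); last first.
  by rewrite /slf_rule -hE (negbTE nolead) fE cE.
rewrite /slf_rule -hE ex lE; congr (nat_of_bool (_ && _))%:R.
have allE (P P' : pred nat) : P =1 P' -> (forall k, P k -> k \in jobs I) ->
    (forall k, P' k -> k \in jobs I') ->
    all (fun i => P i ==> (j <= i)%N) (jobs I) = all (fun i => P' i ==> (j <= i)%N) (jobs I').
  move=> PP' PI PI'; apply/allP/allP => le i _; apply/implyP => Pi.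
    by apply: (implyP (le i _)); rewrite ?PI ?PP'.
  by apply: (implyP (le i _)); rewrite -?PP'// PI' -?PP'.
exact: (allE _ _ lE (fun k lk => active_jobs k t (leads_active I S k t lk))
  (fun k lk => active_jobs k t' (leads_active I' S' k t' lk))).
Qed.

(** A released but unrevealed job has more than eps p > 0 left and is therefore active, so the
    observation and the work done determine which jobs are known and unknown. *)
Lemma slf_rule_observation I S I' S' t t' :
  (forall j, observation eps I S j t = observation eps I' S' j t') ->
  (forall j, processed S j t = processed S' j t') ->
  forall j, slf_rule I S j t = slf_rule I' S' j t'.
Proof.
move=> obs eE.
have e0 := eps_gt0 heps.
have relE j : released I j t = released I' j t'.
  by have := obs j; rewrite /observation; case: (released I j t); case: (released I' j t').
have revE j : released I j t -> revealed eps I S j t = revealed eps I' S' j t'.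
  move=> rj; have := obs j; rewrite /observation -relE rj.
  by case: (revealed eps I S j t); case: (revealed eps I' S' j t').
have remE j : released I j t -> revealed eps I S j t ->
    remaining I S j t = remaining I' S' j t'.
  move=> rj vj; have := obs j; rewrite /observation -relE rj -revE// vj => -[_ pE].
  by rewrite /remaining pE eE.
have unrev I0 S0 j u : released I0 j u -> ~~ revealed eps I0 S0 j u ->
    0 < remaining I0 S0 j u.
  move=> /andP[/proc_gt0 p0 _]; rewrite -ltNge; apply: lt_trans.
  exact: mulr_gt0.
apply: slf_rule_ext => // [j|j|j].
- rewrite /known /active -relE; case rj: (released I j t) => //=.
  by rewrite -revE//; case vj: (revealed eps I S j t); rewrite ?andbF// remE.
- rewrite /unknown /active -relE; case rj: (released I j t) => //=.
  rewrite -revE//; case vj: (revealed eps I S j t); rewrite ?andbF//=.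
  by rewrite !unrev -?relE// -?revE// vj.
- by move=> /andP[/andP[rj _] vj]; exact: remE.
Qed.

(** Following the current rates for a short time does not change the decision: a leader gets further
    ahead, and the front jobs advance together until they meet another job or a threshold. *)
Lemma slf_rule_persist I S t : (forall j, is_rate (S j)) ->
  exists2 d, 0 < d & forall S' u, (forall j, is_rate (S' j)) -> t <= u < t + d ->
    (forall j, processed S' j u = processed S j t + (u - t) * slf_rule I S j t) ->
    forall j, slf_rule I S' j u = slf_rule I S j t.
Proof.
move=> rateS; have k0 := gap_ge0 heps.
(* No job is released strictly between [t] and t + v1. *)
have [v1 v10 rel] := pos_lower_bound (jobs I) (fun j => release I j - t).
have relE u j : t <= u < t + v1 -> released I j u = released I j t.
  move=> /andP[tu utv]; rewrite /released; case jJ: (j \in jobs I) => //=.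
  apply/idP/idP => [ru|/le_trans]; last exact.
  by rewrite leNgt; apply/negP => tr; have := rel j jJ; rewrite subr_gt0 => /(_ tr); lra.
have same S' u j : t <= u < t + v1 -> processed S' j u = processed S j t ->
    [/\ known eps I S' j u = known eps I S j t, unknown eps I S' j u = unknown eps I S j t &
        remaining I S' j u = remaining I S j t].
  move=> tuv eE; have rE : remaining I S' j u = remaining I S j t by rewrite /remaining eE.
  by rewrite /known /unknown /active /revealed relE// rE.
have [/least_leader[k lk wE]|nolead] :=
    boolP (has (fun k => @leads R eps I S k t) (jobs I)).
  have ak := leads_active I S k t lk; have [_ rk0] := andP ak.
  exists (Num.min v1 (remaining I S k t)); first by rewrite lt_min v10.
  move=> S' u rateS' /andP[tu]; rewrite -ltrBlDl lt_min => /andP[hv1 hrk] eE.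
  have tuv : t <= u < t + v1 by rewrite tu -ltrBlDl.
  have other j : j != k -> processed S' j u = processed S j t.
    by move=> /negbTE jk; rewrite eE wE jk mulr0 addr0.
  have ekE : processed S' k u = processed S k t + (u - t) by rewrite eE wE eqxx mulr1.
  have rkE : remaining I S' k u = remaining I S k t - (u - t).
    by rewrite /remaining ekE opprD addrA.
  have h0 : 0 <= u - t by rewrite subr_ge0.
  have /leads_allP[kk le] := lk.
  have kk' : known eps I S' k u.
    move: kk; rewrite /known /active !(revealedE heps) relE// => /andP[/andP[-> _] vk].
    rewrite rkE subr_gt0 hrk/= ekE (le_trans (ler_wpM2l k0 (_ : _ <= remaining I S k t)))//.
      by rewrite lerBlDr lerDl.
    by rewrite (le_trans vk)// lerDl.
  have lk' : @leads R eps I S' k u.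
    apply/leads_allP; split => // j; have [->|jk] := eqVneq j k.
      by split => // /andP[_]; case/andP: kk' => _ ->.
    have [-> -> rE] := same S' u j tuv (other j jk); have [h1 h2] := le j.
    rewrite rkE rE (other j jk); split => [/h1|/h2].
      by apply: le_trans; rewrite lerBlDr lerDl.
    by apply: le_trans; rewrite ler_wpM2l// lerBlDr lerDl.
  have [u_eq|ut] := eqVneq u t.
    move=> j; apply: slf_rule_observation => i.
      have eiE : processed S' i u = processed S i t by rewrite eE u_eq subrr mul0r addr0.
      by rewrite /observation relE// /revealed /remaining eiE.
    by rewrite eE u_eq subrr mul0r addr0.
  have {}h0 : 0 < u - t by rewrite subr_gt0 lt_neqAle eq_sym ut.
  (* Having run for a positive time, [k] is strictly ahead of all other known jobs, so earlier ties
     are resolved in its favour. *)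
  have unique i : @leads R eps I S' i u -> i = k.
    move=> li; apply/eqP/negPn/negP => ik.
    have [_ /(_ k)[/(_ kk') + _]] := (leads_allP _ _ _ _).1 li.
    have [kiE _ riE] := same S' u i tuv (other i ik).
    have ki : known eps I S i t by rewrite -kiE; case/andP: li.
    by have [/(_ ki) + _] := le i; rewrite riE rkE; move: h0; clear; lra.
  have ex' : has (fun k => @leads R eps I S' k u) (jobs I).
    by apply/hasP; exists k => //; exact: (active_jobs k t ak).
  have [i li E'] := least_leader I S' u ex'.
  by move=> j; rewrite E' wE (unique i li).
(* With neither a leader nor a front job nothing runs, and nothing changes before the next
   release. *)
have [fr|nofr] := boolP (has (fun i => @in_front R eps I S i t) (jobs I)); last first.
  have w0 j : slf_rule I S j t = 0.
    rewrite /slf_rule (negbTE nolead); case: ifPn => // fj.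
    case/hasP: nofr; exists j => //.
    exact: (active_jobs j t (in_front_active I S j t fj)).
  exists v1 => // S' u rateS' tuv eE j.
  have e_eq i : processed S' i u = processed S i t by rewrite eE w0 mulr0 addr0.
  by apply: slf_rule_ext => // i; have [] := same S' u i tuv (e_eq i).
have [i0 i0J fi0] := hasP fr.
pose x := processed S i0 t; pose m := count (fun i => @in_front R eps I S i t) (jobs I).
have wE j : slf_rule I S j t = if @in_front R eps I S j t then m%:R^-1 else 0.
  by rewrite /slf_rule (negbTE nolead).
have /in_front_allP[ui0 le0] := fi0.
have frontx j : @in_front R eps I S j t -> processed S j t = x.
  move=> /in_front_allP[uj lej]; apply/le_anti/andP; split; first exact: lej.
  exact: le0.
have frontE j : unknown eps I S j t -> processed S j t <= x -> @in_front R eps I S j t.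
  move=> uj ejx; apply/in_front_allP; split => // i ui.
  by rewrite (le_trans ejx)// le0.
have gap j : active I S j t -> x < kappa * remaining I S j t.
  by move=> aj; have [] := in_front_le heps rateS i0 j t nolead fi0 aj.
(* [v2] is the distance of the front to the thresholds kappa r of the active jobs, [v3] its distance
   to the next larger amount of work. *)
have [v2 v20 gap2] := pos_lower_bound (jobs I) (fun j => kappa * remaining I S j t - x).
have [v3 v30 gap3] := pos_lower_bound (jobs I) (fun j => processed S j t - x).
have k1 : 0 < 1 + kappa by rewrite ltr_wpDr.
have m0 : (0 < m)%N by rewrite -has_count.
have mV0 : 0 < m%:R^-1 :> R by rewrite invr_gt0 ltr0n.
have mV1 : m%:R^-1 <= 1 :> R by rewrite invf_le1 ?ltr0n// ler1n.
(* When the front advances by g, its work grows by g and its own thresholds kappa r fall by kappa g,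
   which closes the gap by (1 + kappa) g. *)
exists (Num.min v1 (Num.min v2 v3 / (1 + kappa))).
  by rewrite lt_min v10 divr_gt0// lt_min v20.
move=> S' u rateS' /andP[tu]; rewrite -ltrBlDl lt_min => /andP[hv1 hv] eE.
have tuv : t <= u < t + v1 by rewrite tu -ltrBlDl.
have h0 : 0 <= u - t by rewrite subr_ge0.
set g := (u - t) / m%:R.
have g0 : 0 <= g by rewrite divr_ge0.
have [gv2 gv3] : g * (1 + kappa) < v2 /\ g < v3.
  move: hv; rewrite ltr_pdivlMr// lt_min => /andP[hv2 hv3].
  have gh : g <= u - t by rewrite ler_piMr.
  have : g * (1 + kappa) <= (u - t) * (1 + kappa) by rewrite ler_pM2r.
  have : g * 1 <= g * (1 + kappa) by rewrite ler_wpM2l// lerDl.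
  by move: hv2 hv3; clear; lra.
have off j : ~~ @in_front R eps I S j t -> processed S' j u = processed S j t.
  by move=> /negbTE fj; rewrite eE wE fj mulr0 addr0.
have on j : @in_front R eps I S j t -> processed S' j u = x + g.
  by move=> fj; rewrite eE wE fj frontx.
have unk_on j : @in_front R eps I S j t -> unknown eps I S' j u.
  move=> fj; have aj := in_front_active I S j t fj; have jJ := active_jobs j t aj.
  have := gap2 j jJ; rewrite subr_gt0 => /(_ (gap j aj)) gj.
  have rE : remaining I S' j u = remaining I S j t - g.
    by rewrite /remaining on// frontx// opprD addrA.
  have lt : x + g < kappa * remaining I S' j u.
    by rewrite rE; move: gv2 gj; clear; lra.
  rewrite /unknown /active (revealedE heps) -ltNge on// lt andbT relE//.
  case/andP: aj => -> _ /=; rewrite ltNge; apply/negP => r_le0.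
  have x0 : 0 <= x by exact: cumul_ge0.
  by have := ler_wpM2l k0 r_le0; move: lt g0 x0; rewrite mulr0; clear; lra.
have known_on j : @in_front R eps I S j t -> known eps I S' j u = false.
  by move=> /unk_on/andP[_ /negbTE vj]; rewrite /known vj andbF.
have kE j : known eps I S' j u = known eps I S j t.
  have [fj|/off eq] := boolP (@in_front R eps I S j t); last by have [] := same S' u j tuv eq.
  rewrite known_on//; have /andP[/andP[_ /negbTE vj] _] := fj.
  by rewrite /known vj andbF.
have uE j : unknown eps I S' j u = unknown eps I S j t.
  have [fj|/off eq] := boolP (@in_front R eps I S j t); last by have [] := same S' u j tuv eq.
  by rewrite unk_on//; case/andP: fj.
have fE j : @in_front R eps I S' j u = @in_front R eps I S j t.
  apply/idP/idP => [/in_front_allP[uj lej]|fj].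
    apply/negPn/negP => nfj; have uj' : unknown eps I S j t by rewrite -uE.
    have jJ := unknown_jobs j t uj'.
    have xj : x < processed S j t.
      by rewrite ltNge; apply/negP => /(frontE j uj'); apply/negP.
    have := gap3 j jJ; rewrite subr_gt0 => /(_ xj).
    have := lej i0 (unk_on i0 fi0); rewrite off// on//.
    by move: gv3; clear; lra.
  apply/in_front_allP; split=> [|i ui]; first exact: unk_on.
  rewrite on//; have [/on -> //|nfi] := boolP (@in_front R eps I S i t).
  rewrite off//; rewrite uE in ui.
  have xi : x < processed S i t.
    by rewrite ltNge; apply/negP => /(frontE i ui); apply/negP.
  have := gap3 i (unknown_jobs i t ui); rewrite subr_gt0 => /(_ xi).
  by move: gv3; clear; lra.
have nolead' : ~~ has (fun k => @leads R eps I S' k u) (jobs I).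
  apply/hasPn => k _; apply/negP => /leads_allP[kk /(_ i0)[_ /(_ (unk_on i0 fi0))]].
  rewrite on//; have nfk : ~~ @in_front R eps I S k t.
    by apply/negP => /known_on; rewrite kk.
  have [kkE _ rE] := same S' u k tuv (off k nfk); rewrite rE.
  have ak : active I S k t by move: kk; rewrite kkE => /andP[].
  have := gap2 k (active_jobs k t ak); rewrite subr_gt0 => /(_ (gap k ak)).
  have : g * 1 <= g * (1 + kappa) by rewrite ler_wpM2l// lerDl.
  by move: gv2; clear; lra.
move=> j; rewrite wE /slf_rule (negbTE nolead') fE; case: ifP => // _.
by rewrite /m; congr (_%:R^-1); apply: eq_count.
Qed.

End Rule.

(** * Existence and uniqueness of the rule's schedule *)

Section Construction.
Context {R : realType} {eps : R} (heps : 0 < eps <= 1).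
Implicit Types (I : instance R) (S : schedule R) (T : \bar R) (i j k : nat) (t u : R).
Local Notation rule := (@slf_rule R eps).

(** A solution of the rule on [0, T), extended by zero. Constancy on the right of every time is what
    makes such a solution unique. *)
Record canonical I S T : Prop := {
  canonical_measurable : forall j, measurable_fun [set: R] (S j);
  canonical_out : forall j t, ~~ ((0 <= t) && (t%:E < T)%E) -> S j t = 0;
  canonical_rule : forall j t, 0 <= t -> (t%:E < T)%E -> S j t = rule I S j t;
  canonical_right : forall t, 0 <= t -> (t%:E < T)%E ->
    exists2 d, 0 < d & forall j u, t <= u < t + d -> (u%:E < T)%E -> S j u = S j t
}.

Arguments canonical_out {I S T}.
Arguments canonical_rule {I S T}.
Arguments canonical_right {I S T}.

Lemma canonical_feasible I S T : canonical I S T -> feasible I S.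
Proof.
move=> [mS outS ruleS _].
(* At each time the rates are either all zero or those of the rule. *)
have inside (P : (nat -> R) -> Prop) t : P (fun=> 0) -> P ((rule I S)^~ t) -> P (S^~ t).
  move=> P0 P1; case/boolP : ((0 <= t) && (t%:E < T)%E) => [/andP[t0 tT]|out].
    by rewrite (_ : S^~ t = (rule I S)^~ t)//; apply/funext => j; rewrite ruleS.
  by rewrite (_ : S^~ t = fun=> 0)//; apply/funext => j; rewrite outS.
split => // [j t|t|j t nr].
- apply: (inside (fun f => 0 <= f j)) => //; exact: slf_rule_ge0.
- apply: (inside (fun f => \sum_(j <- jobs I) f j <= 1)); last exact: slf_rule_sum.
  by rewrite big1.
- apply: (inside (fun f => f j = 0)) => //; exact: slf_rule_unreleased.
Qed.

Lemma canonical_is_SLF I S : canonical I S +oo%E -> is_SLF eps I S.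
Proof.
move=> canS; have feasS := canonical_feasible I S +oo%E canS.
have rateS := feasible_rate feasS.
split => // t t0; have SE j : S j t = rule I S j t.
  by apply: (canonical_rule canS) => //; rewrite ltry.
case: ifPn => [act|none]; last first.
  move=> j; rewrite SE slf_rule_inactive//; apply: contra none => aj.
  by apply/hasP; exists j => //; exact: (active_jobs j t aj).
rewrite -(has_leads heps rateS)//; case: ifPn => [ex|nolead].
  have [k lk ruleE] := least_leader I S t ex.
  have /(leadsP heps rateS)[kk kE _] := lk.
  by exists k; split => // j; rewrite SE ruleE.
move=> j; rewrite SE /slf_rule (negbTE nolead).
by rewrite (mem_argmin_unknown heps rateS) (card_argmin_unknown heps rateS).
Qed.

(** At the last time up to which the works agree, the rates agree by [step]; both stay constant for
    a while, so the agreement would extend further. With one instance this is uniqueness, with two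
    it is non-anticipation. *)
Lemma canonical_agree I S T I' S' T' t :
  canonical I S T -> canonical I' S' T' -> 0 <= t -> (t%:E < T)%E -> (t%:E < T')%E ->
  (forall u, 0 <= u <= t -> (forall j, processed S j u = processed S' j u) ->
    forall j, rule I S j u = rule I' S' j u) ->
  forall j, S j t = S' j t.
Proof.
move=> canS canS' t0 tT tT' step.
have rateS := feasible_rate (canonical_feasible _ _ _ canS).
have rateS' := feasible_rate (canonical_feasible _ _ _ canS').
have [||z [/andP[z0 zt] eqz after]] := @last_time R
    (fun u => forall w j, w <= u -> processed S j w = processed S' j w) 0 t.
- exists 0; rewrite ?lexx ?t0// => w j w0.
  by rewrite -[LHS]/(cumul _ _) -[RHS]/(cumul _ _) !cumul_le0.
- move=> s /andP[s0 st] appr w j ws.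
  have [ws'|ws'] := ltP w s.
    have [|x [sx _ eqx]] := appr (s - w); first by rewrite subr_gt0.
    by apply: eqx; lra.
  have -> : w = s by apply/le_anti/andP.
  apply/eqP; rewrite -subr_eq0 -normr_le0; apply/ler_addgt0Pr => d d0; rewrite add0r.
  have [|x [sx /andP[x0 xs] eqx]] := appr (d / 2); first by rewrite divr_gt0.
  have exE := eqx x j (lexx x).
  rewrite -[processed S j s]/(cumul (S j) s) -[processed S' j s]/(cumul (S' j) s).
  rewrite -[processed S j x]/(cumul (S j) x) -[processed S' j x]/(cumul (S' j) x) in exE.
  have h1 := cumul_mono _ _ _ (rateS j) xs; have h2 := cumulB_le _ _ _ (rateS j) xs.
  have h3 := cumul_mono _ _ _ (rateS' j) xs; have h4 := cumulB_le _ _ _ (rateS' j) xs.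
  by rewrite ler_norml; move: exE h1 h2 h3 h4 sx; clear; lra.
have zT : (z%:E < T)%E by apply: le_lt_trans tT; rewrite lee_fin.
have zT' : (z%:E < T')%E by apply: le_lt_trans tT'; rewrite lee_fin.
have Sz j : S j z = S' j z.
  rewrite (canonical_rule canS)// (canonical_rule canS')//.
  by apply: step => [|i]; [rewrite z0|exact: eqz].
have [<- //|zt'] := eqVneq z t.
have {}zt : z < t by rewrite lt_neqAle zt'.
have [d d0 cS] := canonical_right canS z z0 zT.
have [d' d'0 cS'] := canonical_right canS' z z0 zT'.
pose y := Num.min t (z + Num.min d d').
have zy : z < y by rewrite lt_min zt ltrDl lt_min d0.
exfalso; apply: (after y); first by rewrite zy ge_min lexx.
move=> w j wy; have [wz|/ltW zw] := leP w z; first exact: eqz.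
have lin (P : schedule R) (T0 : \bar R) d0' : (forall i, is_rate (P i)) ->
    (t%:E < T0)%E -> (forall j u, z <= u < z + d0' -> (u%:E < T0)%E -> P j u = P j z) ->
    Num.min d d' <= d0' ->
    processed P j w = processed P j z + P j z * (w - z).
  move=> rP tT0 cP dd; apply/eqP; rewrite addrC -subr_eq; apply/eqP.
  apply: (cumulB_cst (P j)) => // s /andP[zs sw].
  have sy : s < y by exact: lt_le_trans wy.
  move: sy; rewrite lt_min => /andP[st sd]; apply: cP.
    by rewrite (ltW zs)/= (lt_le_trans sd)// lerD2l.
  by apply: lt_trans tT0; rewrite lte_fin.
rewrite (lin S T d)//; last by rewrite ge_min lexx.
by rewrite (lin S' T' d')// ?ge_min ?lexx ?orbT// Sz eqz.
Qed.

Lemma canonical_eq I S T S' T' t :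
  canonical I S T -> canonical I S' T' -> 0 <= t -> (t%:E < T)%E -> (t%:E < T')%E ->
  forall j, S j t = S' j t.
Proof.
move=> canS canS' t0 tT tT'; apply: (canonical_agree _ _ _ _ _ _ _ canS canS') => //.
move=> u _ eE; apply: (slf_rule_observation heps) => // j.
by rewrite /observation /revealed /remaining eE.
Qed.

Lemma processed_eq S S' j t : (forall u, 0 <= u -> u < t -> S j u = S' j u) ->
  is_rate (S j) -> is_rate (S' j) -> processed S j t = processed S' j t.
Proof.
move=> eqS rS rS'.
have [t0|/ltW t0] := leP t 0.
  by rewrite -[LHS]/(cumul _ _) -[RHS]/(cumul _ _) !cumul_le0.
have := @cumulB R (S j) 0 t rS (lexx 0) t0.
have := @cumulB R (S' j) 0 t rS' (lexx 0) t0.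
rewrite !(cumul_le0 _ 0)// !subr0 -[processed S j t]/(cumul _ _).
rewrite -[processed S' j t]/(cumul _ _) => -> ->.
apply: eq_Rintegral => u; rewrite inE/= in_itv/= => /andP[u0 ut].
by apply: eqS => //; exact: ltW.
Qed.

Lemma slf_rule_processed I S S' t : (forall j, processed S j t = processed S' j t) ->
  forall j, rule I S j t = rule I S' j t.
Proof.
move=> eE; apply: (slf_rule_observation heps) => // j.
by rewrite /observation /revealed /remaining eE.
Qed.

Lemma canonical_le I S T T' : (T' <= T)%E -> canonical I S T ->
  exists S', canonical I S' T'.
Proof.
move=> T'T canS; have rS := feasible_rate (canonical_feasible _ _ _ canS).
pose D : set R := [set t | (t%:E < T')%E].
have mD : measurable D.
  rewrite /D; case: T' {T'T D} => [x| |].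
  - have -> : [set t | (t%:E < x%:E)%E] = `]-oo, x[%classic.
      by apply/seteqP; split => t; rewrite /= in_itv/= lte_fin.
    exact: measurable_itv.
  - have -> : [set t : R | (t%:E < +oo)%E] = setT.
      by apply/seteqP; split => t //= _; exact: ltry.
    exact: measurableT.
  - have -> : [set t : R | (t%:E < -oo)%E] = set0 by apply/seteqP; split => t.
    exact: measurable0.
pose S' : schedule R := fun j => (S j) \_ D.
have S'E j t : S' j t = if (t%:E < T')%E then S j t else 0.
  rewrite /S' patchE; case: ifPn => [|tD]; first by rewrite inE => ->.
  by case: ifPn => // tT'; move: tD; rewrite mem_set.
have mS' j : measurable_fun [set: R] (S' j).
  by apply/(measurable_restrictT _ _).1 => //; exact: measurable_funS (rS j).1.
have rS' j : is_rate (S' j).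
  split => // t; rewrite S'E; case: ifP => _; last by rewrite lexx ler01.
  exact: (rS j).2.
have eE j t : (t%:E < T')%E -> processed S' j t = processed S j t.
  move=> tT'; apply: processed_eq => // u _ ut; rewrite S'E.
  by rewrite (lt_trans _ tT')// lte_fin.
exists S'; split => //.
- move=> j t out; rewrite S'E; case: ifPn => // tT'.
  by apply: (canonical_out canS); apply: contra out => /andP[-> _].
- move=> j t t0 tT'; rewrite S'E tT' (canonical_rule canS)//; last exact: lt_le_trans T'T.
  by apply: slf_rule_processed => i; rewrite eE.
- move=> t t0 tT'; have [d d0 cS] := canonical_right canS t t0 (lt_le_trans tT' T'T).
  exists d => // j u tu uT'; rewrite !S'E uT' tT'; apply: cS => //.
  exact: lt_le_trans T'T.
Qed.

(** By uniqueness the partial solutions agree where they overlap. At each time their rates are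
    eventually constant in n, so the glued rate is measurable as a pointwise limit. *)
Lemma canonical_glue I (Tn : nat -> R) T : {homo Tn : m n / (m <= n)%N >-> m <= n} ->
  (forall n, ((Tn n)%:E <= T)%E) -> (forall t, (t%:E < T)%E -> exists n, t < Tn n) ->
  (forall n, exists S, canonical I S (Tn n)%:E) -> exists S, canonical I S T.
Proof.
move=> mono TnT cover /choice[F canF].
have rF n := feasible_rate (canonical_feasible _ _ _ (canF n)).
have /choice[idx idxP] : forall t, exists n, (t%:E < T)%E -> t < Tn n.
  move=> t; have [tT|tT] := boolP (t%:E < T)%E; last by exists 0%N.
  by have [n tn] := cover t tT; exists n.
pose S : schedule R := fun j t => if (t%:E < T)%E then F (idx t) j t else 0.
have SE n j t : 0 <= t -> t < Tn n -> S j t = F n j t.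
  move=> t0 tn; have tT : (t%:E < T)%E by apply: lt_le_trans (TnT n); rewrite lte_fin.
  rewrite /S tT; apply: (canonical_eq _ _ _ _ _ _ (canF (idx t)) (canF n)) => //.
  by rewrite lte_fin; exact: idxP.
have Sout j t : ~~ ((0 <= t) && (t%:E < T)%E) -> S j t = 0 /\ forall n, F n j t = 0.
  move=> out.
  have Fout n : F n j t = 0.
    apply: (canonical_out (canF n)); apply: contra out => /andP[-> tn].
    exact: lt_le_trans (TnT n).
  by split => //; rewrite /S; case: ifP.
have mS j : measurable_fun [set: R] (S j).
  apply: (measurable_fun_cvg (h := fun n => F n j)) => [n|t _]; first exact: (rF n j).1.
  apply: cvg_near_cst.
  have [/andP[t0 tT]|out] := boolP ((0 <= t) && (t%:E < T)%E).
    exists (idx t) => // n /= tn; apply/esym/SE => //.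
    by apply: (lt_le_trans (idxP t tT)); exact: mono.
  by apply: nearW => n; have [-> ->] := Sout j t out.
have rS j : is_rate (S j).
  split => // t; rewrite /S; case: ifP => _; last by rewrite lexx ler01.
  exact: (rF (idx t) j).2.
have eE n j t : t < Tn n -> processed S j t = processed (F n) j t.
  move=> tn; apply: processed_eq => // u u0 ut.
  by apply: SE => //; exact: lt_trans tn.
exists S; split => //.
- by move=> j t /(Sout j)[].
- move=> j t t0 tT; have tn := idxP t tT; rewrite (SE (idx t))//.
  rewrite (canonical_rule (canF (idx t)))// ?lte_fin//.
  by apply: slf_rule_processed => i; rewrite (eE (idx t)).
- move=> t t0 tT; have tn := idxP t tT.
  have [|d d0 cF] := canonical_right (canF (idx t)) t t0; first by rewrite lte_fin.
  exists (Num.min d (Tn (idx t) - t)); first by rewrite lt_min d0 subr_gt0.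
  move=> j u /andP[tu]; rewrite -ltrBlDl lt_min => /andP[ud utn] _.
  rewrite ltrD2r in utn; rewrite !(SE (idx t))//; last exact: le_trans tu.
  by apply: cF; rewrite ?lte_fin// tu -ltrBlDl.
Qed.

(** The rates of the rule at [x] are kept on [x, x + d), where [slf_rule_persist] shows that they
    continue to obey the rule. *)
Lemma canonical_extend I S (x : R) : 0 <= x -> canonical I S x%:E ->
  exists2 d, 0 < d & exists S', canonical I S' (x + d)%:E.
Proof.
move=> x0 canS; have rS := feasible_rate (canonical_feasible _ _ _ canS).
have [d d0 persist] := slf_rule_persist heps I S x rS.
exists d => //; pose w j := rule I S j x.
pose S' : schedule R := fun j t => S j t + w j * \1_(`[x, x + d[%classic) t.
have Sx j t : x <= t -> S j t = 0.
  by move=> xt; apply: (canonical_out canS); rewrite lte_fin ltNge xt andbF.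
have S'lt j t : t < x -> S' j t = S j t.
  move=> tx; rewrite /S' indicE memNset ?mulr0 ?addr0//=.
  by rewrite in_itv/= leNgt tx.
have S'mid j t : x <= t -> t < x + d -> S' j t = w j.
  move=> xt txd; rewrite /S' Sx// add0r indicE mem_set ?mulr1//=.
  by rewrite in_itv/= xt.
have S'ge j t : x + d <= t -> S' j t = 0.
  move=> xdt; rewrite /S' Sx ?add0r; last by apply: le_trans xdt; rewrite lerDl ltW.
  by rewrite indicE memNset ?mulr0//= in_itv/= ltNge xdt/= andbF.
have mS' j : measurable_fun [set: R] (S' j).
  apply: measurable_funD; first exact: (rS j).1.
  by apply: measurable_funM => //; apply: measurable_indic; exact: measurable_itv.
have w01 j : 0 <= w j <= 1.
  rewrite slf_rule_ge0/=; have [jJ|jJ] := boolP (j \in jobs I); last first.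
    by rewrite /w slf_rule_unreleased ?ler01// /released (negbTE jJ).
  apply: le_trans (@slf_rule_sum R eps I S x).
  by rewrite (bigD1_seq j) ?fset_uniq//= lerDl sumr_ge0// => i _; exact: slf_rule_ge0.
have rS' j : is_rate (S' j).
  split => // t; have [tx|xt] := ltP t x; first by rewrite S'lt//; exact: (rS j).2.
  have [txd|xdt] := ltP t (x + d); first by rewrite S'mid.
  by rewrite S'ge// lexx ler01.
have elt j t : t <= x -> processed S' j t = processed S j t.
  by move=> tx; apply: processed_eq => // u _ ut; apply: S'lt; exact: lt_le_trans tx.
have emid j t : x <= t -> t < x + d ->
    processed S' j t = processed S j x + (t - x) * rule I S j x.
  move=> xt txd; rewrite -(elt j x)// mulrC; apply/eqP; rewrite addrC -subr_eq; apply/eqP.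
  apply: (cumulB_cst (S' j)) => // u /andP[xu ut]; apply: S'mid; first exact: ltW.
  exact: lt_trans txd.
exists S'; split => //.
- move=> j t; rewrite negb_and lte_fin -!ltNge => /orP[t0|]; last by rewrite -leNgt; exact: S'ge.
  rewrite S'lt; last exact: lt_le_trans x0.
  by apply: (canonical_out canS); rewrite leNgt t0.
- move=> j t t0; rewrite lte_fin => txd; have [tx|xt] := ltP t x.
    rewrite S'lt// (canonical_rule canS)//.
    by apply: slf_rule_processed => i; rewrite elt// ltW.
  rewrite S'mid//; apply/esym; apply: persist => //; first by rewrite xt.
  by move=> i; exact: emid.
- move=> t t0; rewrite lte_fin => txd; have [tx|xt] := ltP t x.
    have [//|d' d'0 cS] := canonical_right canS t t0.
    exists (Num.min d' (x - t)); first by rewrite lt_min d'0 subr_gt0.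
    move=> j u /andP[tu]; rewrite -ltrBlDl lt_min => /andP[ud ux] _.
    rewrite ltrD2r in ux; rewrite !S'lt//; apply: cS => //.
    by rewrite tu -ltrBlDl.
  exists d => // j u /andP[tu _]; rewrite lte_fin => uxd.
  by rewrite !S'mid//; exact: le_trans tu.
Qed.

(** The horizons of solutions are closed downwards. If they were bounded, gluing would reach their
    supremum and [canonical_extend] would go beyond it; being unbounded, they allow gluing along the
    integers. *)
Lemma canonical_exists I : exists S, canonical I S +oo%E.
Proof.
pose E : set R := [set x | exists S, canonical I S x%:E].
have E0 : E 0.
  exists (fun _ _ => 0); split => // [j t t0|t t0].
    by rewrite lte_fin ltNge t0.
  by rewrite lte_fin ltNge t0.
have Ele x y : x <= y -> E y -> E x.
  by move=> xy [S canS]; apply: (canonical_le _ _ _ _ _ canS); rewrite lee_fin.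
have [bounded|unbounded] := pselect (has_ubound E); last first.
  apply: (canonical_glue I (fun n => n%:R)) => [m n mn|n|t _|n].
  - by rewrite ler_nat.
  - exact: leey.
  - exists (Num.bound `|t|); apply: (le_lt_trans (ler_norm t)).
    exact: archi_boundP.
  - apply: contrapT => none; apply: unbounded; exists n%:R => x Ex.
    by rewrite leNgt; apply/negP => /ltW nx; apply: none; exact: Ele Ex.
have supE : has_sup E by split => //; exists 0.
have s0 : 0 <= sup E by apply: ub_le_sup.
have [S canS] : E (sup E).
  apply: (canonical_glue I (fun n => sup E - n.+1%:R^-1)) => [m n mn|n|t|n].
  - by rewrite lerD2l lerN2 lef_pV2 ?posrE ?ltr0n// ler_nat.
  - by rewrite lee_fin gerBl invr_ge0.
  - rewrite lte_fin => tE; exists (Num.bound (sup E - t)^-1).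
    rewrite ltrBrDl -ltrBrDr invf_plt ?posrE ?ltr0n ?subr_gt0//.
    apply: (lt_le_trans (archi_boundP _)); first by rewrite invr_ge0 subr_ge0 ltW.
    by rewrite ler_nat.
  - have [|y Ey ny] := sup_adherent (_ : 0 < n.+1%:R^-1) supE; first by rewrite invr_gt0 ltr0n.
    by apply: Ele Ey; exact: ltW.
have [d d0 Ed] := canonical_extend I S (sup E) s0 canS.
by have := ub_le_sup bounded Ed; rewrite gerDl leNgt d0.
Qed.

End Construction.

Theorem theorem1p1 (R : realType) (eps : R) (heps : 0 < eps <= 1) :
  (exists A : algorithm R,
     [/\ forall I : instance R, is_SLF eps I (A I),
         clairvoyant_online eps A &
         competitive (Num.ceil (1 / eps))%:~R A]) /\
  (forall (I : instance R) (S : schedule R), is_SLF eps I S ->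
     (total_flow I S <= ((Num.ceil (1 / eps))%:~R)%:E * opt_flow I)%E).
Proof.
have bound I S : is_SLF eps I S ->
    (total_flow I S <= ((Num.ceil (1 / eps))%:~R)%:E * opt_flow I)%E.
  move=> slfS; have [e0 e1] := andP heps.
  have c0 : 0 < Num.ceil (1 / eps) by rewrite ceil_gt0 div1r invr_gt0.
  have cE : (Num.ceil (1 / eps))%:~R = (absz (Num.ceil (1 / eps)))%:R :> R.
    by rewrite -[in LHS](gtz0_abs c0).
  have cR0 : 0 < (Num.ceil (1 / eps))%:~R :> R by rewrite ltr0z.
  (* The positive ratio is moved to the left so that the infimum can be bounded schedule by
     schedule, then moved back. *)
  rewrite -lee_pdivrMl//; apply: le_ereal_inf_tmp => _ [S' feasS' <-].
  rewrite lee_pdivrMl// cE; apply: (SLF_flow_le heps slfS _ feasS').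
  by rewrite /clairvoyance_gap subrKC -cE (le_trans _ (ceil_ge _))// div1r.
split => //; have [A canA] := choice (canonical_exists heps).
exists A; split => [I|I I' t t0 obs|I].
- exact: canonical_is_SLF.
(* Equal observations and equal works force equal rates, so the schedules of the two instances
   cannot separate before [t]. *)
- apply: (canonical_agree _ _ _ _ _ _ _ (canA I) (canA I')); rewrite ?ltry//.
  move=> u ut eE; apply: (slf_rule_observation heps) => // j.
  exact: obs.
- by apply: bound; exact: canonical_is_SLF.
Qed.
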